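(* Let $p\in(1,\infty)$ and $y\in(0,1]$ be fixed. The function $q\mapsto\sinh_{p,q}(y)$ is log-convex (strictly log-convex) on $(1,\infty)$ if and only if for all $q\in(1,\infty)$, with $x=\sinh_{p,q}(y)$, $$\frac{p+(p-q)x^q}{px(1+x^q)^{1-1/p}}\left(\int_0^x\alpha_1(q,t)\,dt\right)^2+\frac{2x^q\log x}{1+x^q}\int_0^x\alpha_1(q,t)\,dt+\int_0^x\alpha_2(q,t)\,dt\le0\quad(<0),$$ where $$\alpha_1(q,t)=-\frac{t^q\log(t)}{(1+t^q)^{1+1/p}},\qquad\alpha_2(q,t)=\frac{t^q(t^q-p)[\log(t)]^2}{(1+t^q)^{2+1/p}}.$$
   Context: For $p,q>1$, $\operatorname{arcsinh}_{p,q}(x)=\int_0^x(1+t^q)^{-1/p}\,dt$ for $x\ge0$, $\hat\pi_{p,q}/2=\int_0^\infty(1+t^q)^{-1/p}\,dt\in(0,\infty]$, and $\sinh_{p,q}:[0,\hat\pi_{p,q}/2)\to[0,\infty)$ is the inverse of $\operatorname{arcsinh}_{p,q}$. For fixed $p$, $\bigcap_{q>1}[0,\hat\pi_{p,q}/2]=[0,1]$ and $\hat\pi_{p,q}/2>1$, so $\sinh_{p,q}(y)$ is defined for all $q>1$ when $y\in[0,1]$. A positive function $f$ on an interval is (strictly) log-convex if $f(\lambda a+(1-\lambda)b)\le f(a)^\lambda f(b)^{1-\lambda}$ for all $a,b$ in the interval and $\lambda\in[0,1]$ (with strict inequality for $a\ne b$, $\lambda\in(0,1)$). The parenthesized version is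 the statement with ''strictly log-convex'' and ''$<0$''. *)

(* Defs.v *)
From Stdlib Require Export Reals.
From Stdlib Require Import Lra Classical ClassicalEpsilon.
From Coquelicot Require Export Coquelicot.
Open Scope R_scope.

(* [Rpower t q] is [exp (q * ln t)], and [ln 0 = 0] in the standard library, so
   [Rpower 0 q = 1]; [powp] is the real power of a nonnegative base, with the
   value 0 at [t = 0] that is right for an exponent [q > 0]. *)
Definition powp (t q : R) : R := if Rlt_dec 0 t then Rpower t q else 0.

Definition arcsinh_pq (p q x : R) : R :=
  RInt (fun t => Rpower (1 + powp t q) (- / p)) 0 x.

(* The limit lives in [Rbar], since the improper integral may be infinite. *)
Definition hatpi_half (p q : R) : Rbar := Lim (arcsinh_pq p q) p_infty.

(* Only meaningful for [y] in [0, hatpi_half p q); see [sinh_pq_inverse]. *)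
Definition sinh_pq (p q y : R) : R :=
  epsilon (inhabits 0) (fun x => 0 <= x /\ arcsinh_pq p q x = y).

Definition alpha1 (p q t : R) : R :=
  - (powp t q * ln t / Rpower (1 + powp t q) (1 + / p)).

Definition alpha2 (p q t : R) : R :=
  powp t q * (powp t q - p) * (ln t) ^ 2 / Rpower (1 + powp t q) (2 + / p).

Definition criterion (p q x : R) : R :=
  (p + (p - q) * powp x q) / (p * x * Rpower (1 + powp x q) (1 - / p))
    * (RInt (alpha1 p q) 0 x) ^ 2
  + 2 * powp x q * ln x / (1 + powp x q) * RInt (alpha1 p q) 0 x
  + RInt (alpha2 p q) 0 x.

Definition log_convex_on (I : R -> Prop) (f : R -> R) : Prop :=
  (forall a, I a -> 0 < f a) /\
  (forall a b l, I a -> I b -> 0 <= l <= 1 ->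
     f (l * a + (1 - l) * b) <= Rpower (f a) l * Rpower (f b) (1 - l)).

Definition strictly_log_convex_on (I : R -> Prop) (f : R -> R) : Prop :=
  (forall a, I a -> 0 < f a) /\
  (forall a b l, I a -> I b -> a <> b -> 0 < l < 1 ->
     f (l * a + (1 - l) * b) < Rpower (f a) l * Rpower (f b) (1 - l)).

Lemma continuous_powp (q t : R) : 0 < q -> continuous (fun s => powp s q) t.
Proof.
intros hq.
destruct (Rtotal_order t 0) as [ht|[->|ht]].
- apply (continuous_ext_loc _ (fun _ => 0)); [|apply continuous_const].
  exists (mkposreal (- t) ltac:(lra)); intros s hs.
  apply Rabs_lt_between' in hs; simpl in hs.
  unfold powp; destruct (Rlt_dec 0 s); lra.
- apply continuity_pt_filterlim; intros eps heps.
  exists (Rpower eps (/ q)); split; [apply exp_pos|].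
  intros s [_ hs]; simpl in hs |- *; unfold R_dist in *.
  rewrite Rminus_0_r in hs.
  unfold powp at 2; destruct (Rlt_dec 0 0); [lra|].
  rewrite Rminus_0_r; unfold powp; destruct (Rlt_dec 0 s) as [h|h].
  + rewrite Rabs_pos_eq in hs by lra.
    rewrite Rabs_pos_eq by (left; apply exp_pos).
    replace eps with (Rpower (Rpower eps (/ q)) q).
    * unfold Rpower at 1 2; apply exp_increasing, Rmult_lt_compat_l; [easy|].
      now apply ln_increasing.
    * rewrite Rpower_mult, Rinv_l by lra; now apply Rpower_1.
  + now rewrite Rabs_R0.
- apply (continuous_ext_loc _ (fun s => Rpower s q)).
  + exists (mkposreal t ht); intros s hs.
    apply Rabs_lt_between' in hs; simpl in hs.
    unfold powp; destruct (Rlt_dec 0 s); lra.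
  + apply (ex_derive_continuous (fun s => Rpower s q)); unfold Rpower.
    auto_derive; lra.
Qed.

Lemma powp_ge0 (t q : R) : 0 <= powp t q.
Proof.
unfold powp; destruct (Rlt_dec 0 t); [left; apply exp_pos|lra].
Qed.

Lemma continuous_arcsinh_integrand (p q t : R) : 0 < q ->
  continuous (fun s => Rpower (1 + powp s q) (- / p)) t.
Proof.
intros hq.
apply (continuous_comp (fun s => powp s q) (fun u => Rpower (1 + u) (- / p))).
- now apply continuous_powp.
- assert (h := powp_ge0 t q); unfold Rpower.
  apply (ex_derive_continuous (fun u => exp (- / p * ln (1 + u)))).
  auto_derive; lra.
Qed.

Lemma is_derive_arcsinh_pq (p q x : R) : 0 < q ->
  is_derive (arcsinh_pq p q) x (Rpower (1 + powp x q) (- / p)).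
Proof.
intros hq.
apply (is_derive_RInt (fun s => Rpower (1 + powp s q) (- / p)) (arcsinh_pq p q) 0).
- apply filter_forall; intros y; apply @RInt_correct, ex_RInt_continuous.
  intros z _; exact (continuous_arcsinh_integrand p q _ hq).
- exact (continuous_arcsinh_integrand p q _ hq).
Qed.

Lemma arcsinh_pq_increasing (p q x y : R) : 0 < q ->
  x < y -> arcsinh_pq p q x < arcsinh_pq p q y.
Proof.
intros hq hxy.
apply (incr_function (arcsinh_pq p q) m_infty p_infty
         (fun s => Rpower (1 + powp s q) (- / p))); try easy.
- intros s _ _; now apply is_derive_arcsinh_pq.
- intros s _ _; apply exp_pos.
Qed.

Lemma arcsinh_pq_0 (p q : R) : arcsinh_pq p q 0 = 0.
Proof. exact (RInt_point 0 _). Qed.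

Lemma hatpi_half_Lim_seq (p q : R) :
  hatpi_half p q = Lim_seq (fun n => arcsinh_pq p q (INR n)).
Proof. reflexivity. Qed.

Lemma sinh_pq_arcsinh_pq (p q x : R) : 0 < q -> 0 <= x ->
  Rbar_lt (arcsinh_pq p q x) (hatpi_half p q) /\
  sinh_pq p q (arcsinh_pq p q x) = x.
Proof.
intros hq hx; split.
- apply Rbar_lt_le_trans with (arcsinh_pq p q (x + 1)).
  { apply arcsinh_pq_increasing; lra. }
  rewrite hatpi_half_Lim_seq, <- (Lim_seq_const (arcsinh_pq p q (x + 1))).
  apply Lim_seq_le_loc.
  destruct (nfloor_ex (x + 1)) as [N hN]; [lra|].
  exists (S N); intros n hn; apply le_INR in hn; rewrite S_INR in hn.
  left; apply arcsinh_pq_increasing; lra.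
- unfold sinh_pq.
  destruct (epsilon_spec (inhabits 0)
    (fun z => 0 <= z /\ arcsinh_pq p q z = arcsinh_pq p q x)) as [_ h].
  { now exists x. }
  set (z := epsilon _ _) in *.
  destruct (Rtotal_order z x) as [hz|[hz|hz]]; [exfalso|easy|exfalso];
    apply (arcsinh_pq_increasing p q) in hz; lra.
Qed.

Lemma sinh_pq_inverse (p q y : R) : 0 < q ->
  0 <= y -> Rbar_lt y (hatpi_half p q) ->
  0 <= sinh_pq p q y /\ arcsinh_pq p q (sinh_pq p q y) = y.
Proof.
intros hq hy hlt; apply (epsilon_spec (inhabits 0)
  (fun z => 0 <= z /\ arcsinh_pq p q z = y)).
assert (hn : exists n, y < arcsinh_pq p q (INR n)).
{ apply NNPP; intros hn; apply (Rbar_lt_not_le _ _ hlt).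
  rewrite hatpi_half_Lim_seq, <- (Lim_seq_const y).
  apply Lim_seq_le_loc; exists 0%nat; intros n _.
  apply Rnot_lt_le; intros h; apply hn; now exists n. }
destruct hn as [n hn].
destruct (IVT_gen (arcsinh_pq p q) 0 (INR n) y) as [z [hz <-]].
- intros z; apply continuity_pt_filterlim, @ex_derive_continuous.
  eexists; now apply is_derive_arcsinh_pq.
- rewrite arcsinh_pq_0, Rmin_left, Rmax_right; lra.
- rewrite Rmin_left in hz by apply pos_INR; now exists z.
Qed.

(* Main.v *)
Require Import Defs.
From Stdlib Require Import Lra Lia Psatz.

(** Write u(q) = ln sinh_{p,q}(y), so that arcsinh_{p,q}(e^u) = y. Differentiating
    this identity twice gives u'' = - criterion / (p^2 x (1 + x^q)^(-1/p)) at
    x = e^u. The criterion turns out to be negative at every point with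
    arcsinh_{p,q}(x) <= 1 ([criterion_neg]), so that for 0 < y <= 1 both sides of
    both equivalences hold.

    Strict log-convexity follows without differentiating the implicit function
    ([arcsinh_line_gt]). Along a line ln x = al q + be the arcsinh integral is a
    function of q alone, and at a critical point its second derivative is
    criterion / p^2. It therefore has no interior minimum of value at most 1, and
    the segment between two points of the curve arcsinh = y lies in the region
    arcsinh > y, that is, above the curve.

    For the sign of the criterion put s = q ln x, k = 1/p, r = 1/q,
    m = x (1 + x^q)^(-k), f = x^q / (1 + x^q), and let N = - int u dmu and
    M = int u^2 dmu over u < s for the measure dmu = k f m du. An integration by
    parts turns the criterion into - p^2/q^3 times
      gap = 2 N + k f (s m - N)^2 / m - r M - r N^2 / m     ([criterion_eq_gap]),
    so that r M has to be bounded from above.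

    To the left of x = 1 a second integration by parts and the inequality
    t / (1 + e^t) < 0.279 give (1 + r) M < s^2 k f m + 2.558 N, and this suffices
    because r N <= 5/8 m ([gap_pos_left]).

    To the right of x = 1 the moments are not estimated again. The quantity
    gam N - r N^2 / m - r M, to which the square k f (s m - N)^2 / m is added once
    s m >= N, is nondecreasing if gam satisfies a suitable differential inequality
    and gam <= 2 ([barrier_slope_early], [barrier_slope_late]). It is positive at
    s = 0 by the estimates on the left, and it bounds the gap from below as long as
    N >= 0; after that the gap itself increases ([gap_pos_right]). The bound
    gam <= 2 holds for x^q <= 0.88 + 0.87 q ([growth_le_2]), and
    arcsinh_{p,q}(x) <= 1 forces x into that range ([area_threshold]). Both facts
    reduce to polynomials in q - 1 with positive coefficients. *)

(** * Monotonicity from derivatives *)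

Lemma monotone_of_derive (F dF : R -> R) (a b : R) :
  a <= b ->
  (forall s, a <= s <= b -> is_derive F s (dF s)) ->
  (forall s, a <= s <= b -> 0 <= dF s) -> F a <= F b.
Proof.
intros hab hF hd.
destruct (MVT_gen F a b dF) as [c [hc heq]].
- rewrite Rmin_left, Rmax_right by lra; intros s hs; apply hF; lra.
- rewrite Rmin_left, Rmax_right by lra; intros s hs.
  apply continuity_pt_filterlim, @ex_derive_continuous.
  exists (dF s); now apply hF.
- rewrite Rmin_left, Rmax_right in hc by lra.
  assert (h := hd c hc); nra.
Qed.

Lemma strict_monotone_of_derive (F dF : R -> R) (a b : R) :
  a < b ->
  (forall s, a <= s <= b -> is_derive F s (dF s)) ->
  (forall s, a < s < b -> 0 < dF s) -> F a < F b.
Proof.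
intros hab hF hd.
destruct (MVT_cor2 F dF a b hab) as [c [heq hc]].
- intros s hs; now apply is_derive_Reals, hF.
- assert (h := hd c hc); nra.
Qed.

(** An inequality between antiderivatives normalized to vanish at minus infinity
    becomes a pointwise one; this replaces every improper integral below. *)
Lemma pos_of_lim_m_infty (F dF : R -> R) (b : R) :
  (forall s, s <= b -> is_derive F s (dF s)) ->
  (forall s, s < b -> 0 < dF s) ->
  is_lim F m_infty 0 -> 0 < F b.
Proof.
intros hF hd hl.
assert (h1 : F (b - 1) < F b).
{ apply (strict_monotone_of_derive F dF); [lra| |]; intros s hs;
    [apply hF|apply hd]; lra. }
enough (h0 : Rbar_le 0 (F (b - 1))) by (simpl in h0; lra).
apply (is_lim_le_loc F (fun _ => F (b - 1)) m_infty).
- exists (b - 1); intros s hs.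
  apply (monotone_of_derive F dF); [lra| |]; intros u hu;
    [apply hF|left; apply hd]; lra.
- easy.
- apply is_lim_const.
Qed.

(** * Bounds on the exponential *)

Lemma exp_le_mono (a b : R) : a <= b -> exp a <= exp b.
Proof. intros [h|h]; [left; now apply exp_increasing|rewrite h; lra]. Qed.

Lemma exp_le_1 (a : R) : a <= 0 -> exp a <= 1.
Proof. intros h; apply exp_le_mono in h; now rewrite exp_0 in h. Qed.

Lemma exp_ge_1 (a : R) : 0 <= a -> 1 <= exp a.
Proof. intros h; apply exp_le_mono in h; now rewrite exp_0 in h. Qed.

Lemma exp_ge_quadratic (x : R) : 0 <= x -> 1 + x + x ^ 2 / 2 <= exp x.
Proof.
intros hx.
assert (h : exp 0 - 0 - 0 ^ 2 / 2 <= exp x - x - x ^ 2 / 2).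
{ apply (monotone_of_derive (fun t => exp t - t - t ^ 2 / 2)
    (fun t => exp t - 1 - t)); [easy| |]; intros s hs.
  - auto_derive; [easy|field].
  - assert (h := exp_ineq1_le s); lra. }
rewrite exp_0 in h; lra.
Qed.

Lemma exp_ge_cubic (x : R) : 0 <= x -> 1 + x + x ^ 2 / 2 + x ^ 3 / 6 <= exp x.
Proof.
intros hx.
assert (h : exp 0 - 0 - 0 ^ 2 / 2 - 0 ^ 3 / 6 <= exp x - x - x ^ 2 / 2 - x ^ 3 / 6).
{ apply (monotone_of_derive (fun t => exp t - t - t ^ 2 / 2 - t ^ 3 / 6)
    (fun t => exp t - 1 - t - t ^ 2 / 2)); [easy| |]; intros s hs.
  - auto_derive; [easy|field].
  - assert (h := exp_ge_quadratic s ltac:(lra)); lra. }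
rewrite exp_0 in h; lra.
Qed.

(** Convexity of the exponential between 0 and L. *)
Lemma exp_weighted_le (k L : R) : 0 <= k <= 1 -> exp (k * L) <= 1 - k + k * exp L.
Proof.
intros hk.
assert (h0 := exp_pos (k * L)).
assert (h1 := exp_ineq1_le ((1 - k) * L)).
assert (h2 := exp_ineq1_le (- k * L)).
assert (e1 : exp L = exp (k * L) * exp ((1 - k) * L)).
{ rewrite <- exp_plus; f_equal; ring. }
assert (e2 : 1 = exp (k * L) * exp (- k * L)).
{ rewrite <- exp_plus, <- exp_0; f_equal; ring. }
assert (h3 := Rmult_le_compat_l _ _ _ (Rlt_le _ _ h0) h1).
assert (h4 := Rmult_le_compat_l _ _ _ (Rlt_le _ _ h0) h2).
rewrite <- e1 in h3; rewrite <- e2 in h4; nra.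
Qed.

(** The right-hand side dominates 2 tanh (s / 2). *)
Lemma two_tanh_half_le (s : R) : 0 <= s -> 2 * (exp s - 1) / (1 + exp s) <= s.
Proof.
intros hs; assert (h := exp_pos s).
apply (Rmult_le_reg_r (1 + exp s)); [lra|].
unfold Rdiv; rewrite Rmult_assoc, Rinv_l, Rmult_1_r by lra.
assert (h1 : 0 * (1 + exp 0) - 2 * (exp 0 - 1) <= s * (1 + exp s) - 2 * (exp s - 1)).
{ apply (monotone_of_derive (fun t => t * (1 + exp t) - 2 * (exp t - 1))
    (fun t => 1 - exp t + t * exp t)); [easy| |].
  - intros t _; auto_derive; [easy|ring].
  - intros t ht; assert (h1 := exp_ineq1_le (- t)); assert (h2 := exp_pos t).
    assert (e : exp (- t) * exp t = 1).
    { rewrite <- exp_plus, <- exp_0; f_equal; ring. }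
    nra. }
rewrite exp_0 in h1; lra.
Qed.

Lemma inv_bounds (x : R) : 1 < x -> 0 < / x <= 1.
Proof.
intros hx; split; [apply Rinv_0_lt_compat; lra|].
rewrite <- Rinv_1; apply Rinv_le_contravar; lra.
Qed.

(** * Mass and density in the logarithmic variable *)

Definition logistic (s : R) : R := exp s / (1 + exp s).

(** With s = q ln x, k = 1/p and r = 1/q this is x (1 + x^q)^(-1/p), the derivative
    of the arcsinh integral with respect to ln x. *)
Definition mass (k r s : R) : R := exp (r * s - k * ln (1 + exp s)).

(** The image of the measure - d((1 + x^q)^(-1/p)), weighted by x, under
    x |-> q ln x; the integral of alpha1 is its first moment up to a factor. *)
Definition density (k r s : R) : R := k * logistic s * mass k r s.

Lemma logistic_bounds (s : R) : 0 < logistic s < 1.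
Proof.
assert (h := exp_pos s); unfold logistic.
assert (0 < / (1 + exp s)) by (apply Rinv_0_lt_compat; lra).
split; [apply Rmult_lt_0_compat; lra|].
apply (Rmult_lt_reg_r (1 + exp s)); [lra|].
unfold Rdiv; rewrite Rmult_assoc, Rinv_l; lra.
Qed.

Lemma logistic_ge_half (s : R) : 0 <= s -> / 2 <= logistic s.
Proof.
intros hs; assert (h := exp_ge_1 s hs).
unfold logistic; apply (Rmult_le_reg_r (1 + exp s)); [lra|].
unfold Rdiv; rewrite Rmult_assoc, Rinv_l; lra.
Qed.

Lemma mass_pos (k r s : R) : 0 < mass k r s.
Proof. apply exp_pos. Qed.

Lemma is_derive_logistic (s : R) :
  is_derive logistic s (logistic s * (1 - logistic s)).
Proof.
assert (h := exp_pos s); unfold logistic.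
auto_derive; [lra|field; lra].
Qed.

Lemma is_derive_mass (k r s : R) :
  is_derive (mass k r) s ((r - k * logistic s) * mass k r s).
Proof.
assert (h := exp_pos s); unfold mass, logistic.
auto_derive; [lra|].
unfold Rminus; field; lra.
Qed.

Lemma is_derive_density (k r s : R) :
  is_derive (density k r) s (density k r s * (1 + r - (1 + k) * logistic s)).
Proof.
assert (h := exp_pos s); unfold density, mass, logistic.
auto_derive; [lra|].
unfold Rminus; field; lra.
Qed.

Lemma density_pos (k r s : R) : 0 < k -> 0 < density k r s.
Proof.
intros hk; assert (h := logistic_bounds s); assert (h' := mass_pos k r s).
unfold density; apply Rmult_lt_0_compat; [apply Rmult_lt_0_compat|]; lra.
Qed.

Lemma mass_le_1 (k r s : R) : 0 <= k -> 0 <= r -> s <= 0 -> mass k r s <= 1.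
Proof.
intros hk hr hs; apply exp_le_1.
assert (h : 0 <= ln (1 + exp s)).
{ rewrite <- ln_1; left; apply ln_increasing; assert (h := exp_pos s); lra. }
nra.
Qed.

Lemma density_le_exp (k r s : R) : 0 < k <= 1 -> 0 <= r -> s <= 0 ->
  density k r s <= exp s.
Proof.
intros hk hr hs; assert (h := exp_pos s).
assert (hf : logistic s <= exp s).
{ unfold logistic; apply (Rmult_le_reg_r (1 + exp s)); [lra|].
  unfold Rdiv; rewrite Rmult_assoc, Rinv_l; nra. }
assert (hf' := logistic_bounds s).
assert (hm := mass_le_1 k r s ltac:(lra) hr hs); assert (hm' := mass_pos k r s).
unfold density.
apply Rle_trans with (1 * exp s * 1); [|lra].
apply Rmult_le_compat; [nra|lra| |lra].
apply Rmult_le_compat; lra.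
Qed.

Lemma is_lim_exp_scal (c : R) : 0 < c -> is_lim (fun s => exp (c * s)) m_infty 0.
Proof.
intros hc.
apply (is_lim_comp exp (fun s => c * s) m_infty 0 m_infty).
- apply is_lim_exp_m.
- evar_last; [apply (is_lim_scal_l (fun s => s)), is_lim_id|].
  simpl; destruct (Rle_dec 0 c) as [H|H]; [|lra].
  destruct (Rle_lt_or_eq_dec 0 c H); [easy|lra].
- exists 0; intros; discriminate.
Qed.

(** * Limits at minus infinity *)

Lemma is_lim_sqr_exp : is_lim (fun s => s ^ 2 * exp s) m_infty 0.
Proof.
assert (h : is_lim (fun s => / 2 * s * exp (/ 2 * s)) m_infty 0).
{ apply (is_lim_comp (fun s => s * exp s) (fun s => / 2 * s) m_infty 0 m_infty).
  - apply is_lim_mul_exp_m.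
  - apply (is_lim_ext (fun s => / 2 * s)); [easy|].
    evar_last; [apply (is_lim_scal_l (fun s => s)), is_lim_id|].
    simpl; destruct (Rle_dec 0 (/ 2)) as [H|H]; [|lra].
    destruct (Rle_lt_or_eq_dec 0 (/ 2) H); [easy|lra].
  - exists 0; intros; discriminate. }
assert (h4 : is_lim (fun s =>
  4 * (/ 2 * s * exp (/ 2 * s) * (/ 2 * s * exp (/ 2 * s)))) m_infty 0).
{ evar_last; [apply is_lim_scal_l, (is_lim_mult _ _ _ 0 0); [exact h|exact h|easy]|].
  simpl; f_equal; ring. }
revert h4; apply is_lim_ext; intros s.
replace (exp s) with (exp (/ 2 * s) * exp (/ 2 * s)); [field|].
rewrite <- exp_plus; f_equal; field.
Qed.

Lemma is_lim_squeeze_m_infty (F G : R -> R) :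
  (exists b, forall s, s < b -> 0 <= F s <= G s) ->
  is_lim G m_infty 0 -> is_lim F m_infty 0.
Proof.
intros [b hb] hG.
apply (is_lim_le_le_loc (fun _ => 0) G); [|apply is_lim_const|exact hG].
exists b; exact hb.
Qed.

Lemma is_lim_sqr_density (k r : R) : 0 < k <= 1 -> 0 <= r ->
  is_lim (fun s => s ^ 2 * density k r s) m_infty 0.
Proof.
intros hk hr.
apply (is_lim_squeeze_m_infty _ (fun s => s ^ 2 * exp s)); [|apply is_lim_sqr_exp].
exists 0; intros u hu.
assert (h := density_pos k r u ltac:(lra)).
assert (h' := density_le_exp k r u hk ltac:(lra) ltac:(lra)).
assert (0 <= u ^ 2) by nra; nra.
Qed.

(** The integral of - u e^(c u) over u < s. *)
Definition exp_moment (c s : R) : R := exp (c * s) * (- s / c + / c ^ 2).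

Lemma is_derive_exp_moment (c s : R) : 0 < c ->
  is_derive (exp_moment c) s (- s * exp (c * s)).
Proof.
intros hc; unfold exp_moment; auto_derive; [easy|field; lra].
Qed.

Lemma is_lim_exp_moment (c : R) : 1 <= c -> is_lim (exp_moment c) m_infty 0.
Proof.
intros hc; apply (is_lim_squeeze_m_infty _ (fun s => 2 * (s ^ 2 * exp s))).
- exists (-1); intros s hs; unfold exp_moment.
  assert (hi : 0 < / c <= 1).
  { split; [apply Rinv_0_lt_compat; lra|].
    rewrite <- Rinv_1; apply Rinv_le_contravar; lra. }
  rewrite <- pow_inv.
  assert (he : exp (c * s) <= exp s).
  { apply exp_le_mono; nra. }
  assert (h0 := exp_pos (c * s)).
  assert (h1 : 0 <= - s / c <= - s) by (unfold Rdiv; nra).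
  assert (h2 : 0 <= (/ c) ^ 2 <= 1) by nra.
  split; [apply Rmult_le_pos; lra|].
  apply Rle_trans with (exp s * (2 * s ^ 2)); [|lra].
  apply Rmult_le_compat; nra.
- evar_last; [apply is_lim_scal_l, is_lim_sqr_exp|simpl; f_equal; ring].
Qed.

(** * Moments to the left of one *)

(** The maximum of t / (1 + e^t) over t >= 0 is about 0.2785. This single number
    controls the second moment through an integration by parts. *)
Lemma opp_mul_logistic_lt (s : R) : s <= 0 -> - s * logistic s < 279 / 1000.
Proof.
intros hs; assert (h := exp_pos s).
assert (h1 : exp (- s) * exp s = 1).
{ rewrite <- exp_plus, <- exp_0; f_equal; ring. }
assert (h2 : - s < 279 / 1000 * (exp (- s) + 1)).
{ destruct (Rle_lt_dec (- s) (278 / 1000)) as [hsm|hbig].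
  - assert (h3 := exp_ineq1_le (- s)); lra.
  - assert (he : 35845 / 10000 <= exp (1278 / 1000)).
    { replace (1278 / 1000)
        with (3195 / 10000 + 3195 / 10000 + (3195 / 10000 + 3195 / 10000)) by field.
      rewrite !exp_plus.
      assert (h3 := exp_ge_cubic (3195 / 10000) ltac:(lra)).
      set (u := exp (3195 / 10000)) in *.
      (* With e^1.278 > 1 / 0.279 the tangent of 0.279 e^t at t = 1.278 gives
         0.279 e^t >= t - 0.278. *)
      assert (h4 : 137597 / 100000 <= u) by lra.
      assert (h5 : 137597 / 100000 * (137597 / 100000) <= u * u) by nra.
      set (v := u * u) in *; nra. }
    assert (h3 := exp_ineq1_le (- s - 1278 / 1000)).
    replace (exp (- s)) with (exp (1278 / 1000) * exp (- s - 1278 / 1000))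
      by (rewrite <- exp_plus; f_equal; ring).
    assert (h4 := exp_pos (- s - 1278 / 1000)).
    assert (h5 := Rmult_le_compat_r _ _ _ (Rlt_le _ _ h4) he).
    lra. }
unfold logistic.
apply (Rmult_lt_reg_r (1 + exp s)); [lra|].
replace (- s * (exp s / (1 + exp s)) * (1 + exp s)) with (- s * exp s) by (field; lra).
nra.
Qed.

(** N = - int u dmu and M = int u^2 dmu over u < s, for the measure mu with density
    [density]; they are characterized by derivative and limit so that no improper
    integral has to be formed. *)
Definition log_moments (k r : R) (N M : R -> R) : Prop :=
  (forall s, is_derive N s (- s * density k r s)) /\ is_lim N m_infty 0 /\
  (forall s, is_derive M s (s ^ 2 * density k r s)) /\ is_lim M m_infty 0.

(** A positive multiple of - criterion, where n and mu stand for the two moments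
    (see [criterion_eq_gap]). *)
Definition gap (k r s n mu : R) : R :=
  2 * n + k * logistic s * (s * mass k r s - n) ^ 2 / mass k r s
  - r * mu - r * n ^ 2 / mass k r s.

Lemma first_moment_pos (k r : R) (N M : R -> R) (s : R) :
  0 < k -> log_moments k r N M -> s <= 0 -> 0 < N s.
Proof.
intros hk (hN & hN0 & _) hs.
apply (pos_of_lim_m_infty N (fun s => - s * density k r s)); [auto| |easy].
intros u hu; assert (h := density_pos k r u hk); nra.
Qed.

(** Integrating (u^2 density)' gives
    s^2 density + 2 N = int u^2 (1 + r - (1 + k) logistic) density, and
    - u logistic u < 0.279 bounds the part of the integral with the logistic factor
    by 2 * 0.279 * N. *)
Lemma second_moment_lt (k r : R) (N M : R -> R) (s : R) :
  0 < k <= 1 -> 0 < r -> log_moments k r N M -> s <= 0 ->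
  (1 + r) * M s < s ^ 2 * density k r s + 2558 / 1000 * N s.
Proof.
intros hk hr (hN & hN0 & hM & hM0) hs.
enough (h : 0 < s ^ 2 * density k r s + 2558 / 1000 * N s - (1 + r) * M s) by lra.
apply (pos_of_lim_m_infty
  (fun s => s ^ 2 * density k r s + 2558 / 1000 * N s - (1 + r) * M s)
  (fun s => density k r s * - s * (558 / 1000 - (1 + k) * (- s * logistic s)))).
- intros u hu.
  evar_last.
  + apply @is_derive_minus; [apply @is_derive_plus|].
    * apply (is_derive_mult (fun s => s ^ 2) (density k r) u (2 * u)).
      -- auto_derive; [easy|ring].
      -- apply is_derive_density.
      -- exact Rmult_comm.
    * apply is_derive_scal, hN.
    * apply is_derive_scal, hM.
  + unfold minus, plus, opp, mult; simpl; field.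
- intros u hu.
  assert (h := density_pos k r u ltac:(lra)).
  assert (h1 := opp_mul_logistic_lt u ltac:(lra)).
  assert (h2 := logistic_bounds u).
  apply Rmult_lt_0_compat; [apply Rmult_lt_0_compat; lra|].
  assert (0 < - u * logistic u) by (apply Rmult_lt_0_compat; lra). nra.
- assert (h1 := is_lim_sqr_density k r hk ltac:(lra)).
  evar_last.
  + apply (is_lim_minus _ _ _ (0 + 2558 / 1000 * 0) ((1 + r) * 0)).
    * apply (is_lim_plus _ _ _ 0 (2558 / 1000 * 0)); [exact h1| |easy].
      evar_last; [apply is_lim_scal_l, hN0|easy].
    * evar_last; [apply is_lim_scal_l, hM0|easy].
    * easy.
  + simpl; f_equal; ring.
Qed.

Lemma first_moment_le_sum (k r : R) (N M : R -> R) (G dG : R -> R) (s : R) :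
  log_moments k r N M ->
  (forall u, u <= s -> is_derive G u (- u * dG u)) ->
  (forall u, u < s -> density k r u < dG u) ->
  is_lim G m_infty 0 -> s <= 0 -> N s <= G s.
Proof.
intros (hN & hN0 & _) hG hlt hG0 hs.
enough (0 < G s - N s) by lra.
apply (pos_of_lim_m_infty (fun u => G u - N u)
  (fun u => - u * dG u - - u * density k r u)).
- intros u hu; apply @is_derive_minus; [now apply hG|apply hN].
- intros u hu; assert (h := hlt u hu); nra.
- evar_last; [apply (is_lim_minus _ _ _ 0 0); easy|simpl; f_equal; ring].
Qed.

(** Dropping the factor (1 + e^u)^(-1-k) from the density leaves an elementary
    integral. *)
Lemma first_moment_le_mass (k r : R) (N M : R -> R) (s : R) :
  0 < k <= 1 -> 0 < r <= 1 -> log_moments k r N M -> s <= 0 ->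
  r * N s <= 5 / 8 * mass k r s.
Proof.
intros hk hr hm hs.
assert (hN : N s <= k * exp_moment (1 + r) s).
{ apply (first_moment_le_sum k r N M (fun u => k * exp_moment (1 + r) u)
    (fun u => k * exp ((1 + r) * u)) s hm); [| | |easy].
  - intros u _; evar_last; [apply is_derive_scal, is_derive_exp_moment; lra|ring].
  - intros u hu; unfold density.
    assert (h := exp_pos u).
    replace ((1 + r) * u) with (u + r * u) by ring; rewrite exp_plus, Rmult_assoc.
    apply Rmult_lt_compat_l; [lra|].
    assert (hl : logistic u < exp u).
    { unfold logistic; apply (Rmult_lt_reg_r (1 + exp u)); [lra|].
      unfold Rdiv; rewrite Rmult_assoc, Rinv_l; nra. }
    assert (hl' := logistic_bounds u).
    assert (hms : mass k r u <= exp (r * u)).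
    { apply exp_le_mono.
      assert (0 <= ln (1 + exp u)) by
        (rewrite <- ln_1; left; apply ln_increasing; lra).
      nra. }
    assert (h' := mass_pos k r u); nra.
  - evar_last; [apply is_lim_scal_l, is_lim_exp_moment; lra|].
    simpl; f_equal; ring. }
set (v := exp s) in *; assert (hv := exp_pos s); fold v in hv.
assert (hmass : exp (r * s) <= (1 + v) * mass k r s).
{ replace (exp (r * s)) with (mass k r s * exp (k * ln (1 + v))).
  2: { unfold mass; rewrite <- exp_plus; f_equal; unfold v; ring. }
  assert (h := exp_weighted_le k (ln (1 + v)) ltac:(lra)).
  rewrite exp_ln in h by lra.
  assert (h' := mass_pos k r s).
  rewrite (Rmult_comm (1 + v)).
  apply Rmult_le_compat_l; [lra|nra]. }
assert (hexp : exp_moment (1 + r) s = v * exp (r * s) * (- s * / (1 + r) + (/ (1 + r)) ^ 2)).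
{ unfold exp_moment; replace ((1 + r) * s) with (s + r * s) by ring.
  rewrite exp_plus; fold v; field; lra. }
assert (hi : / 2 <= / (1 + r) <= 1).
{ split; [apply Rinv_le_contravar; lra|].
  rewrite <- Rinv_1; apply Rinv_le_contravar; lra. }
assert (hii : r * / (1 + r) = 1 - / (1 + r)) by (field; lra).
set (i := / (1 + r)) in *.
assert (h1 : r * (- s * i + i ^ 2) <= (1 - 2 * s) / 4).
{ replace (r * (- s * i + i ^ 2)) with (- s * (r * i) + (r * i) * i) by ring.
  rewrite hii; nra. }
(* What is left is v (1 + v) (1 - 2 s) / 4 with v = e^s. *)
assert (h2 : v * (1 - 2 * s) <= 3 / 2).
{ assert (h := exp_ge_quadratic (- s) ltac:(lra)).
  assert (e : exp (- s) * v = 1).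
  { unfold v; rewrite <- exp_plus, <- exp_0; f_equal; ring. }
  assert (h' := Rmult_le_compat_r _ _ _ (Rlt_le _ _ hv) h).
  rewrite e in h'.
  apply Rle_trans with (v * (3 / 2 * (1 + - s + (- s) ^ 2 / 2))); [|nra].
  apply Rmult_le_compat_l; [lra|nra]. }
assert (h3 : v * (v * (1 - 2 * s)) <= 1).
{ assert (h := exp_ineq1_le (- (2 * s))).
  assert (e : exp (- (2 * s)) * (v * v) = 1).
  { unfold v; rewrite <- !exp_plus, <- exp_0; f_equal; ring. }
  assert (h' := Rmult_le_compat_r (v * v) _ _ ltac:(nra) h).
  rewrite e in h'; nra. }
assert (hms := mass_pos k r s).
assert (hE := exp_pos (r * s)).
assert (h4 : 0 <= - s * i + i ^ 2) by nra.
apply Rle_trans with (r * (1 * exp_moment (1 + r) s)).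
{ apply Rmult_le_compat_l; [lra|].
  apply Rle_trans with (1 := hN); apply Rmult_le_compat_r; [|lra].
  rewrite hexp; apply Rmult_le_pos; [|easy]; apply Rmult_le_pos; lra. }
rewrite hexp.
replace (r * (1 * (v * exp (r * s) * (- s * i + i ^ 2))))
  with (exp (r * s) * (v * (r * (- s * i + i ^ 2)))) by ring.
apply Rle_trans with ((1 + v) * mass k r s * (v * ((1 - 2 * s) / 4))).
{ apply Rmult_le_compat; [lra| |easy|].
  - apply Rmult_le_pos; [lra|]; apply Rmult_le_pos; lra.
  - apply Rmult_le_compat_l; lra. }
replace ((1 + v) * mass k r s * (v * ((1 - 2 * s) / 4)))
  with (mass k r s * ((v * (1 - 2 * s) + v * (v * (1 - 2 * s))) / 4)) by field.
rewrite (Rmult_comm (5 / 8)); apply Rmult_le_compat_l; lra.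
Qed.

(** For s <= 0 the square in the gap dominates s^2 density, which absorbs the
    boundary term of [second_moment_lt]; what remains is at least
    (0.721 - 0.625) N. *)
(** At s = 0 the two moment bounds say exactly that the barrier with initial
    coefficient c = second_coef q + k first_coef q starts positive. *)
Lemma gap_pos_left (k r : R) (N M : R -> R) (s : R) :
  0 < k <= 1 -> 0 < r <= 1 -> log_moments k r N M -> s <= 0 ->
  0 < gap k r s (N s) (M s).
Proof.
intros hk hr hm hs.
assert (hN := first_moment_pos k r N M s ltac:(lra) hm hs).
assert (hM := second_moment_lt k r N M s hk ltac:(lra) hm hs).
assert (hNm := first_moment_le_mass k r N M s hk hr hm hs).
assert (hms := mass_pos k r s).
assert (hf := logistic_bounds s).
unfold gap.
assert (e1 : k * logistic s * (s * mass k r s - N s) ^ 2 / mass k r s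
  = s ^ 2 * density k r s + (k * logistic s) * (2 * - s * N s + N s ^ 2 / mass k r s)).
{ unfold density; field; lra. }
assert (h1 : r * N s ^ 2 / mass k r s <= 5 / 8 * N s).
{ apply (Rmult_le_reg_r (mass k r s)); [easy|].
  unfold Rdiv at 1; rewrite (Rmult_assoc _ (/ _)), Rinv_l by lra; nra. }
assert (h2 : 0 <= N s ^ 2 / mass k r s).
{ apply Rmult_le_pos; [nra|left; now apply Rinv_0_lt_compat]. }
assert (h3 : 0 <= (k * logistic s) * (2 * - s * N s + N s ^ 2 / mass k r s)).
{ apply Rmult_le_pos; nra. }
assert (h4 : 0 <= s ^ 2 * density k r s).
{ assert (h := density_pos k r s ltac:(lra)); apply Rmult_le_pos; nra. }
assert (h5 : r * M s <= / 2 * (s ^ 2 * density k r s + 2558 / 1000 * N s)).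
{ apply (Rmult_le_reg_l (1 + r)); [lra|].
  set (u := s ^ 2 * density k r s + 2558 / 1000 * N s) in *.
  assert (0 < u) by (unfold u; nra). nra. }
rewrite e1; lra.
Qed.

(** The cubic is exact at w = 0 and w = 1. *)
Lemma inv_sqr_le_cubic (w : R) : 0 < w < 1 ->
  / (1 + w) ^ 2 < 1 - 3 / 2 * w + 17 / 16 * w ^ 2 - 5 / 16 * w ^ 3.
Proof.
intros hw; apply (Rmult_lt_reg_r ((1 + w) ^ 2)); [nra|].
rewrite Rinv_l by nra.
enough (0 < w * ((1 - w) * (8 - 7 * w - 2 * w ^ 2 + 5 * w ^ 3))) by nra.
apply Rmult_lt_0_compat; [lra|]; apply Rmult_lt_0_compat; [lra|nra].
Qed.

(** The bound for N(0) / (k mass(0)) that results from replacing (1 + w)^(-2) in the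
    density by the cubic of [inv_sqr_le_cubic] and integrating over u < 0. *)
Definition first_bound (r : R) : R :=
  2 * (/ (1 + r) ^ 2 - 3 / 2 * / (2 + r) ^ 2 + 17 / 16 * / (3 + r) ^ 2
       - 5 / 16 * / (4 + r) ^ 2).

(** The density carries (1 + w)^(-1-k) with w = e^u < 1; trading (1 + w)^(1-k) for
    2^(1-k) leaves (1 + w)^(-2) for every k, and turns 2^(-k) into mass(0). *)
Lemma first_moment_0_le (k r : R) (N M : R -> R) :
  0 < k <= 1 -> 0 < r <= 1 -> log_moments k r N M ->
  N 0 <= k * first_bound r * mass k r 0.
Proof.
intros hk hr hm.
apply Rle_trans with (2 * k * mass k r 0 * (exp_moment (1 + r) 0
  - 3 / 2 * exp_moment (2 + r) 0 + 17 / 16 * exp_moment (3 + r) 0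
  - 5 / 16 * exp_moment (4 + r) 0)).
2: { unfold first_bound, exp_moment; rewrite !Rmult_0_r, exp_0; right; field; lra. }
apply (first_moment_le_sum k r N M (fun u => 2 * k * mass k r 0 * (exp_moment (1 + r) u
  - 3 / 2 * exp_moment (2 + r) u + 17 / 16 * exp_moment (3 + r) u
  - 5 / 16 * exp_moment (4 + r) u))
  (fun u => 2 * k * mass k r 0 * (exp ((1 + r) * u) - 3 / 2 * exp ((2 + r) * u)
     + 17 / 16 * exp ((3 + r) * u) - 5 / 16 * exp ((4 + r) * u))) 0 hm); [| | |lra].
- intros u _.
  assert (hd : forall c a, 1 <= c ->
    is_derive (fun u => a * exp_moment c u) u (a * (- u * exp (c * u)))).
  { intros c a hc; apply is_derive_scal, is_derive_exp_moment; lra. }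
  evar_last.
  + apply is_derive_scal, @is_derive_minus; [apply @is_derive_plus;
      [apply @is_derive_minus; [apply is_derive_exp_moment; lra|]|]|];
      apply hd; lra.
  + unfold minus, plus, opp; simpl; field.
- intros u hu.
  assert (hw : 0 < exp u < 1).
  { split; [apply exp_pos|]; rewrite <- exp_0; now apply exp_increasing. }
  assert (hc := inv_sqr_le_cubic _ hw).
  set (w := exp u) in *.
  replace ((1 + r) * u) with (r * u + u) by ring.
  replace ((2 + r) * u) with (r * u + u + u) by ring.
  replace ((3 + r) * u) with (r * u + u + u + u) by ring.
  replace ((4 + r) * u) with (r * u + u + u + u + u) by ring.
  rewrite !exp_plus; fold w.
  apply Rle_lt_trans with (2 * k * mass k r 0 * (exp (r * u) * w) * / (1 + w) ^ 2).
  + assert (e : density k r u = k * (exp (r * u) * w) * / (1 + w) ^ 2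
       * exp ((1 - k) * ln (1 + w))).
    { unfold density, mass, logistic; fold w.
      replace ((1 - k) * ln (1 + w)) with (- (k * ln (1 + w)) + ln (1 + w)) by ring.
      unfold Rminus; rewrite !exp_plus, exp_ln by lra; field; lra. }
    assert (e2 : 2 * mass k r 0 = exp ((1 - k) * ln 2)).
    { unfold mass; rewrite exp_0, Rmult_0_r.
      replace ((1 - k) * ln 2) with (ln 2 + (0 - k * ln 2)) by ring.
      rewrite exp_plus, exp_ln by lra.
      replace (1 + 1) with 2 by ring; ring. }
    rewrite e.
    replace (2 * k * mass k r 0 * (exp (r * u) * w) * / (1 + w) ^ 2) with
      (k * (exp (r * u) * w) * / (1 + w) ^ 2 * (2 * mass k r 0)) by ring.
    rewrite e2.
    assert (0 < / (1 + w) ^ 2) by (apply Rinv_0_lt_compat; nra).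
    assert (he := exp_pos (r * u)).
    apply Rmult_le_compat_l.
    { apply Rmult_le_pos; [|lra]; apply Rmult_le_pos; [lra|]; apply Rmult_le_pos; lra. }
    apply exp_le_mono, Rmult_le_compat_l; [lra|].
    left; apply ln_increasing; lra.
  + assert (he := exp_pos (r * u)); assert (hms := mass_pos k r 0).
    replace (2 * k * mass k r 0 * (exp (r * u) * w - 3 / 2 * (exp (r * u) * w * w) +
       17 / 16 * (exp (r * u) * w * w * w) - 5 / 16 * (exp (r * u) * w * w * w * w)))
    with (2 * k * mass k r 0 * (exp (r * u) * w) *
      (1 - 3 / 2 * w + 17 / 16 * w ^ 2 - 5 / 16 * w ^ 3)) by field.
    apply Rmult_lt_compat_l; [|easy].
    apply Rmult_lt_0_compat; [|apply Rmult_lt_0_compat; lra].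
    apply Rmult_lt_0_compat; lra.
- assert (hl : forall c, 1 <= c -> forall a, is_lim (fun u => a * exp_moment c u) m_infty 0).
  { intros c hc a; evar_last; [apply is_lim_scal_l, is_lim_exp_moment, hc|].
    simpl; f_equal; ring. }
  evar_last.
  { apply is_lim_scal_l, (is_lim_minus _ _ _ (0 - 0 + 0) 0); [|apply hl; lra|easy].
    apply (is_lim_plus _ _ _ (0 - 0) 0); [|apply hl; lra|easy].
    apply (is_lim_minus _ _ _ 0 0); [apply is_lim_exp_moment; lra|apply hl; lra|easy]. }
  simpl; f_equal; ring.
Qed.

(** * A barrier to the right of one *)

(** With gam = 2 and b = 1 this is the gap. As long as N >= 0, a smaller gam and the
    omission of the square (b = 0) give lower bounds whose derivative has a sign. *)
Definition barrier (k r : R) (gam N M : R -> R) (b s : R) : R :=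
  gam s * N s - r * N s ^ 2 / mass k r s - r * M s
  + b * (k * logistic s * (s * mass k r s - N s) ^ 2 / mass k r s).

Definition barrier_slope (k r : R) (gam dgam N : R -> R) (b s : R) : R :=
  let m := mass k r s in let f := logistic s in let g := k * f in
  let T := s * m - N s in
  (- gam s * g * m * T + m * (dgam s - gam s * g) * N s - r * g * T ^ 2
   + r ^ 2 * N s ^ 2
   + b * (g * (1 - f) * T ^ 2 + 2 * g * T * m * (1 + r * s) - g * T ^ 2 * (r - g))) / m.

(** Since m' = (r - k f) m, N' = - s k f m and M' = s^2 k f m, multiplying the
    derivative by m makes it polynomial in N and T = s m - N. *)
Lemma is_derive_barrier (k r : R) (gam dgam N M : R -> R) (b s : R) :
  log_moments k r N M -> is_derive gam s (dgam s) ->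
  is_derive (barrier k r gam N M b) s (barrier_slope k r gam dgam N b s).
Proof.
intros (hN & _ & hM & _) hg; unfold barrier, barrier_slope.
assert (hm := mass_pos k r s).
assert (xN : ex_derive N s) by (eexists; apply hN).
assert (xM : ex_derive M s) by (eexists; apply hM).
assert (xg : ex_derive gam s) by (eexists; apply hg).
assert (xm : ex_derive (mass k r) s) by (eexists; apply is_derive_mass).
assert (xf : ex_derive logistic s) by (eexists; apply is_derive_logistic).
assert (dN := is_derive_unique _ _ _ (hN s)).
assert (dM := is_derive_unique _ _ _ (hM s)).
assert (dg := is_derive_unique _ _ _ hg).
assert (dm := is_derive_unique _ _ _ (is_derive_mass k r s)).
assert (df := is_derive_unique _ _ _ (is_derive_logistic s)).
unfold density in dN, dM.
set (m := mass k r) in *; clearbody m.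
set (f := logistic) in *; clearbody f.
auto_derive.
- repeat split; first [assumption | lra].
- change (Derive (fun x => N x) s) with (Derive N s); rewrite dN.
  change (Derive (fun x => M x) s) with (Derive M s); rewrite dM.
  change (Derive (fun x => gam x) s) with (Derive gam s); rewrite dg.
  change (Derive (fun x => m x) s) with (Derive m s); rewrite dm.
  change (Derive (fun x => f x) s) with (Derive f s); rewrite df.
  field; lra.
Qed.

Lemma gap_barrier (k r : R) (gam N M : R -> R) (s : R) :
  gap k r s (N s) (M s) = barrier k r gam N M 1 s + (2 - gam s) * N s.
Proof.
unfold gap, barrier; assert (hm := mass_pos k r s); field; lra.
Qed.

(** The sign of this quantity decides whether the square helps the barrier. *)
Definition excess (k r : R) (N : R -> R) (s : R) : R := s * mass k r s - N s.

Lemma is_derive_excess (k r : R) (N M : R -> R) (s : R) : log_moments k r N M ->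
  is_derive (excess k r N) s (mass k r s * (1 + r * s)).
Proof.
intros (hN & _); unfold excess.
assert (xN : ex_derive N s) by (eexists; apply hN).
assert (xm : ex_derive (mass k r) s) by (eexists; apply is_derive_mass).
assert (dN := is_derive_unique _ _ _ (hN s)).
assert (dm := is_derive_unique _ _ _ (is_derive_mass k r s)).
unfold density in dN.
set (m := mass k r) in *; clearbody m.
auto_derive.
- repeat split; assumption.
- change (Derive (fun x => N x) s) with (Derive N s); rewrite dN.
  change (Derive (fun x => m x) s) with (Derive m s); rewrite dm.
  ring.
Qed.

(** The choice of gam: the linear equation gam' = k logistic gam would give the
    first term alone, and the second one exploits the spare square r^2 N^2 in the
    slope of the barrier. It is c at s = 0. *)
Definition growth (k r c s : R) : R :=
  c * exp (k * (ln (1 + exp s) - ln 2)) - k * r ^ 2 * s ^ 2 / 2.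

Definition growth_slope (k r c s : R) : R :=
  k * logistic s * c * exp (k * (ln (1 + exp s) - ln 2)) - k * r ^ 2 * s.

Lemma is_derive_growth (k r c s : R) :
  is_derive (growth k r c) s (growth_slope k r c s).
Proof.
assert (h := exp_pos s); unfold growth, growth_slope, logistic.
auto_derive; [lra|].
unfold Rminus; field; lra.
Qed.

Lemma growth_slope_ge (k r c s : R) : 0 < k ->
  - (k * r ^ 2 * s) <= growth_slope k r c s - growth k r c s * (k * logistic s).
Proof.
intros hk; assert (h := logistic_bounds s).
unfold growth, growth_slope.
enough (0 <= k * r ^ 2 * s ^ 2 / 2 * (k * logistic s)) by nra.
apply Rmult_le_pos; [|nra].
assert (0 <= r ^ 2 * s ^ 2) by nra; nra.
Qed.

Lemma barrier_le (k r : R) (gam dgam N M : R -> R) (b s t : R) :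
  log_moments k r N M -> s <= t ->
  (forall u, is_derive gam u (dgam u)) ->
  (forall u, s <= u <= t -> 0 <= barrier_slope k r gam dgam N b u) ->
  barrier k r gam N M b s <= barrier k r gam N M b t.
Proof.
intros hm hst hg hs.
apply (monotone_of_derive _ (barrier_slope k r gam dgam N b)); [easy| |easy].
intros u _; now apply is_derive_barrier.
Qed.

(** With T = s m - N <= 0 and delta = gam' - k f gam >= - k r^2 s, m times the slope
    is - k f T (gam m + r T) + N (r^2 N + m delta), and both parts are nonnegative:
    N has decreased since 0, so gam m >= r N - r s m. *)
Lemma barrier_slope_early (k r c : R) (N M : R -> R) (s : R) :
  0 < k <= 1 -> 0 < r <= 1 -> log_moments k r N M ->
  r * N 0 <= c * mass k r 0 -> 0 <= s -> r * s <= 2 -> N s <= N 0 ->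
  excess k r N s <= 0 ->
  0 <= barrier_slope k r (growth k r c) (growth_slope k r c) N 0 s.
Proof.
intros hk hr hm hc hs hrs hN hT.
assert (hms := mass_pos k r s); assert (hf := logistic_bounds s).
assert (hd := growth_slope_ge k r c s ltac:(lra)).
unfold excess in hT; unfold barrier_slope.
set (m := mass k r s) in *; set (f := logistic s) in *.
set (d := growth_slope k r c s - growth k r c s * (k * f)) in *.
set (T := s * m - N s) in *.
assert (hg : 0 <= growth k r c s * m + r * T).
{ assert (e : growth k r c s * m = c * mass k r 0 * exp (r * s)
     - k * r ^ 2 * s ^ 2 / 2 * m).
  { unfold growth, m, mass; rewrite exp_0, Rmult_0_r.
    replace (1 + 1) with 2 by ring.
    rewrite Rmult_minus_distr_r.
    replace (c * exp (0 - k * ln 2) * exp (r * s))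
      with (c * (exp (0 - k * ln 2) * exp (r * s))) by ring.
    rewrite Rmult_assoc, <- !exp_plus; do 3 f_equal; ring. }
  assert (he : 1 <= exp (r * s)) by (apply exp_ge_1; nra).
  assert (hN0 : 0 <= N s) by (unfold T in hT; nra).
  rewrite e; unfold T.
  assert (h1 : r * N s <= c * mass k r 0 * exp (r * s)).
  { apply Rle_trans with (c * mass k r 0 * 1); [nra|].
    apply Rmult_le_compat_l; nra. }
  assert (h2 : 0 <= r * s * m * (1 - k * (r * s) / 2)).
  { apply Rmult_le_pos; [apply Rmult_le_pos; nra|nra]. }
  nra. }
assert (hNs : s * m <= N s) by (unfold T in hT; lra).
assert (h0 : 0 <= s * m) by nra.
apply Rmult_le_pos; [|left; now apply Rinv_0_lt_compat].
assert (h1 : 0 <= - T * (k * f) * (growth k r c s * m + r * T)).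
{ apply Rmult_le_pos; [apply Rmult_le_pos; nra|easy]. }
assert (h2 : 0 <= N s * (r ^ 2 * N s + m * d)).
{ apply Rmult_le_pos; [lra|].
  assert (m * - (k * r ^ 2 * s) <= m * d) by (apply Rmult_le_compat_l; lra).
  assert (k * (s * m) <= N s) by nra.
  assert (0 <= r ^ 2) by nra.
  assert (r ^ 2 * (k * (s * m)) <= r ^ 2 * N s) by (apply Rmult_le_compat_l; lra).
  nra. }
nra.
Qed.

(** Adding the square completes the quadratic part to (k f T + r N)^2 with
    T = s m - N, which pays for - k r^2 s m N because s m = T + N and logistic s >= 1/2. *)
Lemma barrier_slope_late (k r c : R) (N M : R -> R) (s : R) :
  0 < k <= 1 -> 0 < r <= 1 -> log_moments k r N M ->
  0 <= s -> 0 <= N s -> 0 <= excess k r N s -> growth k r c s <= 2 ->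
  0 <= barrier_slope k r (growth k r c) (growth_slope k r c) N 1 s.
Proof.
intros hk hr hm hs hN hT hg.
assert (hms := mass_pos k r s); assert (hf := logistic_bounds s).
assert (hf2 := logistic_ge_half s hs).
assert (hd := growth_slope_ge k r c s ltac:(lra)).
unfold excess in hT; unfold barrier_slope.
set (m := mass k r s) in *; set (f := logistic s) in *.
set (d := growth_slope k r c s - growth k r c s * (k * f)) in *.
set (G := growth k r c s) in *.
remember (s * m - N s) as T eqn:eT.
apply Rmult_le_pos; [|left; now apply Rinv_0_lt_compat].
replace (_ + 1 * _) with
  ((2 - G) * (k * f) * m * T + (k * f * T + r * N s) ^ 2 + k * f * (1 - f) * T ^ 2
   + m * d * N s).
2: { replace (N s) with (s * m - T) by lra; ring. }
assert (h1 : 0 <= (2 - G) * (k * f) * m * T).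
{ apply Rmult_le_pos; [apply Rmult_le_pos; [apply Rmult_le_pos; nra|lra]|lra]. }
assert (h2 : 0 <= k * f * (1 - f) * T ^ 2) by
  (apply Rmult_le_pos; [apply Rmult_le_pos; nra|apply pow2_ge_0]).
assert (h3 : - (k * r ^ 2 * (T + N s) * N s) <= m * d * N s).
{ replace (T + N s) with (s * m) by lra.
  assert (m * - (k * r ^ 2 * s) <= m * d) by (apply Rmult_le_compat_l; lra).
  assert (h := Rmult_le_compat_r (N s) _ _ hN H); nra. }
assert (h4 : k * r ^ 2 * (T + N s) * N s <= (k * f * T + r * N s) ^ 2).
{ assert (h5 : 0 <= T * N s) by nra.
  assert (h6 : k * r ^ 2 * (T * N s) <= 2 * (k * f) * r * (T * N s)).
  { apply Rmult_le_compat_r; [easy|].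
    assert (0 < k * r) by nra. nra. }
  assert (h7 : k * (r * N s) ^ 2 <= (r * N s) ^ 2) by nra.
  nra. }
lra.
Qed.

Lemma zero_between (F dF : R -> R) (a b : R) : a <= b ->
  (forall u, is_derive F u (dF u)) -> F a * F b <= 0 ->
  exists t, a <= t <= b /\ F t = 0.
Proof.
intros hab hF h.
destruct (IVT_gen F a b 0) as [t [ht h0]].
- intros u; apply continuity_pt_filterlim, @ex_derive_continuous.
  eexists; apply hF.
- unfold Rmin, Rmax; destruct (Rle_dec (F a) (F b)); split; nra.
- rewrite Rmin_left, Rmax_right in ht by lra; now exists t.
Qed.

(** The barrier starts positive at 0. It increases without the square until
    s mass = N, then with the square as long as N >= 0, and gam <= 2 turns it into a
    lower bound for the gap. After N has changed sign the gap itself increases,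
    since the only negative term of its slope, - 2 k f m N, has become positive. *)
Lemma gap_pos_right (k r c : R) (N M : R -> R) (s : R) :
  0 < k <= 1 -> 0 < r <= 1 -> log_moments k r N M ->
  r * N 0 <= c * mass k r 0 ->
  r * M 0 + r * N 0 ^ 2 / mass k r 0 < c * N 0 ->
  0 <= s -> r * s <= 2 -> (forall u, 0 <= u <= s -> growth k r c u <= 2) ->
  0 < gap k r s (N s) (M s).
Proof.
intros hk hr hm hc1 hc2 hs hrs hg.
assert (hN := proj1 hm).
assert (hN0 := first_moment_pos k r N M 0 ltac:(lra) hm ltac:(lra)).
set (gam := growth k r c) in *; set (dgam := growth_slope k r c).
assert (hgam : forall u, is_derive gam u (dgam u)) by (intros u; apply is_derive_growth).
assert (hdec : forall u t, 0 <= u -> u <= t -> N t <= N u).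
{ intros u t hu hut.
  enough (- N u <= - N t) by lra.
  apply (monotone_of_derive (fun v => - N v) (fun v => - (- v * density k r v))); [easy| |].
  - intros v _; apply (is_derive_opp N), hN.
  - intros v hv; assert (h := density_pos k r v ltac:(lra)); nra. }
assert (hinc : forall u t, 0 <= u -> u <= t -> excess k r N u <= excess k r N t).
{ intros u t hu hut.
  apply (monotone_of_derive _ (fun v => mass k r v * (1 + r * v))); [easy| |].
  - intros v _; now apply (is_derive_excess k r N M).
  - intros v hv; assert (h := mass_pos k r v); apply Rmult_le_pos; nra. }
assert (hb0 : 0 < barrier k r gam N M 0 0).
{ unfold barrier, gam, growth; rewrite exp_0.
  replace (1 + 1) with 2 by ring.
  replace (ln 2 - ln 2) with 0 by ring.
  rewrite Rmult_0_r, exp_0; unfold Rdiv in *; lra. }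
assert (hphase1 : forall t, 0 <= t <= s -> excess k r N t <= 0 ->
   0 < barrier k r gam N M 0 t).
{ intros t ht hT; apply Rlt_le_trans with (1 := hb0).
  apply (barrier_le k r gam dgam); [easy|lra|easy|].
  intros u hu; apply (barrier_slope_early k r c N M); try easy; try nra.
  - apply hdec; lra.
  - apply Rle_trans with (2 := hT); apply hinc; lra. }
assert (hphase2 : forall t, 0 <= t <= s -> 0 <= N t ->
   0 < barrier k r gam N M 1 t).
{ assert (hle : forall t, barrier k r gam N M 0 t <= barrier k r gam N M 1 t).
  { intros t; unfold barrier.
    enough (0 <= k * logistic t * (t * mass k r t - N t) ^ 2 / mass k r t) by lra.
    assert (h := logistic_bounds t); assert (h' := mass_pos k r t).
    apply Rmult_le_pos; [|left; now apply Rinv_0_lt_compat].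
    apply Rmult_le_pos; [nra|apply pow2_ge_0]. }
  intros t ht hNt.
  destruct (Rle_lt_dec (excess k r N t) 0) as [hT|hT].
  { apply Rlt_le_trans with (2 := hle t); now apply hphase1. }
  destruct (zero_between (excess k r N) (fun v => mass k r v * (1 + r * v)) 0 t)
    as [t0 [ht0 h0]]; [lra| | |].
  { intros u; now apply (is_derive_excess k r N M). }
  { unfold excess at 1; nra. }
  apply Rlt_le_trans with (barrier k r gam N M 1 t0).
  { apply Rlt_le_trans with (2 := hle t0); apply hphase1; lra. }
  apply (barrier_le k r gam dgam); [easy|lra|easy|].
  intros u hu; apply (barrier_slope_late k r c N M); try easy; try lra.
  - apply Rle_trans with (1 := hNt), hdec; lra.
  - rewrite <- h0; apply hinc; lra.
  - apply hg; lra. }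
destruct (Rle_lt_dec 0 (N s)) as [hNs|hNs].
{ rewrite (gap_barrier k r gam N M).
  assert (h := hphase2 s ltac:(lra) hNs); assert (h' := hg s ltac:(lra)); nra. }
destruct (zero_between N (fun v => - v * density k r v) 0 s) as [t [ht h0]];
  [lra|exact hN|nra|].
assert (e : forall u, gap k r u (N u) (M u) = barrier k r (fun _ => 2) N M 1 u).
{ intros u; rewrite (gap_barrier k r (fun _ => 2) N M); ring. }
apply Rlt_le_trans with (gap k r t (N t) (M t)).
{ rewrite (gap_barrier k r gam N M), h0, Rmult_0_r, Rplus_0_r.
  apply hphase2; [lra|rewrite h0; lra]. }
rewrite !e.
apply (barrier_le k r _ (fun _ => 0)); [easy|lra| |].
{ intros u; apply (is_derive_const 2). }
intros u hu; unfold barrier_slope.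
assert (hms := mass_pos k r u); assert (hf := logistic_bounds u).
assert (hNu : N u <= 0) by (rewrite <- h0; apply hdec; lra).
apply Rmult_le_pos; [|left; now apply Rinv_0_lt_compat].
set (m := mass k r u) in *; set (f := logistic u) in *.
replace (_ + 1 * _) with ((k * f * (u * m - N u) + r * N u) ^ 2
  + k * f * (1 - f) * (u * m - N u) ^ 2 + 2 * (k * f) * m * - N u) by ring.
assert (h1 : 0 <= k * f * (1 - f) * (u * m - N u) ^ 2).
{ apply Rmult_le_pos; [apply Rmult_le_pos; nra|apply pow2_ge_0]. }
assert (h2 : 0 <= 2 * (k * f) * m * - N u).
{ apply Rmult_le_pos; [apply Rmult_le_pos; nra|lra]. }
assert (h3 := pow2_ge_0 (k * f * (u * m - N u) + r * N u)).
lra.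
Qed.

(** * The coefficient stays below two *)

(** The bound for r M(0) / N(0) that [second_moment_lt] gives with r = 1/q. *)
Definition second_coef (q : R) : R := 2558 / 1000 / (q + 1).

(** The value of r * [first_bound] r at r = 1/q. *)
Definition first_coef (q : R) : R :=
  2 * q * (/ (q + 1) ^ 2 - 3 / 2 * / (2 * q + 1) ^ 2 + 17 / 16 * / (3 * q + 1) ^ 2
           - 5 / 16 * / (4 * q + 1) ^ 2).

Lemma first_coef_ge0 (q : R) : 1 < q -> 0 <= first_coef q.
Proof.
intros hq; unfold first_coef; apply Rmult_le_pos; [lra|].
assert (h1 : 3 / 2 * / (2 * q + 1) ^ 2 <= / (q + 1) ^ 2).
{ apply (Rmult_le_reg_r ((2 * q + 1) ^ 2 * (q + 1) ^ 2)); [apply Rmult_lt_0_compat; nra|].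
  field_simplify; [|lra|lra]. nra. }
assert (h2 : 5 / 16 * / (4 * q + 1) ^ 2 <= 17 / 16 * / (3 * q + 1) ^ 2).
{ assert (/ (4 * q + 1) ^ 2 <= / (3 * q + 1) ^ 2).
  { apply Rinv_le_contravar; nra. }
  assert (0 < / (4 * q + 1) ^ 2) by (apply Rinv_0_lt_compat; nra). lra. }
lra.
Qed.

Ltac horner_pos :=
  repeat match goal with
  | |- 0 <= ?a + ?z * ?b => apply Rplus_le_le_0_compat; [lra|apply Rmult_le_pos; [lra|]]
  | |- 0 <= _ => lra
  end.

(** The left-hand side bounds the coefficient at x^q = 0.88 + 0.87 q with k = 1. Over a
    common denominator the difference to 2 is a polynomial in q - 1 with positive
    coefficients. *)
Lemma growth_end_le (q : R) : 1 < q ->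
  let e := (87 / 100 * q - 12 / 100) / 2 in
  (1 + e) * (second_coef q + first_coef q) - 2 * e ^ 2 / (q ^ 2 * (1 + e) ^ 2) <= 2.
Proof.
intros hq e; unfold e, second_coef, first_coef; clear e.
set (z := q - 1); replace q with (1 + z) by (unfold z; ring).
assert (hz : 0 <= z) by (unfold z; lra); clearbody z; clear q hq.
set (e := (87 / 100 * (1 + z) - 12 / 100) / 2).
assert (he : 0 < 1 + e) by (unfold e; lra).
enough (h : 0 <= 2 - ((1 + e) * (2558 / 1000 / (1 + z + 1) +
  2 * (1 + z) * (/ (1 + z + 1) ^ 2 - 3 / 2 * / (2 * (1 + z) + 1) ^ 2
  + 17 / 16 * / (3 * (1 + z) + 1) ^ 2 - 5 / 16 * / (4 * (1 + z) + 1) ^ 2))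
  - 2 * e ^ 2 / ((1 + z) ^ 2 * (1 + e) ^ 2))) by lra.
replace (2 - _) with ((2771826562500 + z * (38678229937500 + z * (198680955098125
  + z * (560254823044200 + z * (1010355716704720
  + z * (1256240012185798 + z * (1119715192551856
  + z * (727241619266272 + z * (343369260557964 + z * (115214511284122
  + z * (26089749201159 + z * (3578239119708
  + z * 224791761276)))))))))))) / 8000000000
  / ((1 + z) ^ 2 * (1 + e) ^ 2 * (1 + z + 1) ^ 2 * (2 * (1 + z) + 1) ^ 2
     * (3 * (1 + z) + 1) ^ 2 * (4 * (1 + z) + 1) ^ 2)).
- apply Rmult_le_pos.
  + apply Rmult_le_pos; [horner_pos|lra].
  + left; apply Rinv_0_lt_compat; repeat apply Rmult_lt_0_compat; nra.
- unfold e; field; repeat split; lra.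
Qed.

(** The subtracted term grows with slope at most 1/q^2, because x / (1 + x)^2 <= 1/4,
    and second_coef q >= 1/q^2. *)
Lemma growth_end_monotone (q e1 e2 : R) : 1 < q -> 0 <= e1 <= e2 ->
  (1 + e1) * (second_coef q + first_coef q) - 2 * e1 ^ 2 / (q ^ 2 * (1 + e1) ^ 2)
  <= (1 + e2) * (second_coef q + first_coef q) - 2 * e2 ^ 2 / (q ^ 2 * (1 + e2) ^ 2).
Proof.
intros hq he.
assert (hb := first_coef_ge0 q hq).
assert (ha : / q ^ 2 <= second_coef q).
{ unfold second_coef; apply (Rmult_le_reg_r (q ^ 2 * (q + 1))); [nra|].
  field_simplify; [|lra|lra]. nra. }
assert (e : forall x, 0 <= x -> 2 * x ^ 2 / (q ^ 2 * (1 + x) ^ 2) =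
  2 * / q ^ 2 * (x / (1 + x)) ^ 2) by (intros x hx; field; lra).
rewrite !e by lra.
assert (hi : 0 < / q ^ 2) by (apply Rinv_0_lt_compat; nra).
assert (hd : (e2 / (1 + e2)) ^ 2 - (e1 / (1 + e1)) ^ 2 <= (e2 - e1) / 2).
{ assert (e0 : e2 / (1 + e2) - e1 / (1 + e1) = (e2 - e1) * (/ (1 + e1) * / (1 + e2)))
    by (field; lra).
  assert (hq1 : forall x, 0 <= x -> x / (1 + x) * / (1 + x) <= / 4).
  { intros x hx; apply (Rmult_le_reg_r ((1 + x) ^ 2)); [nra|].
    replace (x / (1 + x) * / (1 + x) * (1 + x) ^ 2) with x by (field; lra).
    assert (h := pow2_ge_0 (1 - x)); lra. }
  assert (hq2 : forall x, 0 <= x -> 0 < / (1 + x) <= 1).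
  { intros x hx; split; [apply Rinv_0_lt_compat; lra|].
    rewrite <- Rinv_1; apply Rinv_le_contravar; lra. }
  assert (hq3 : forall x, 0 <= x -> 0 <= x / (1 + x)).
  { intros x hx; apply Rmult_le_pos; [easy|]; assert (h := hq2 x hx); lra. }
  replace ((e2 / (1 + e2)) ^ 2 - (e1 / (1 + e1)) ^ 2)
    with ((e2 / (1 + e2) - e1 / (1 + e1)) * (e2 / (1 + e2) + e1 / (1 + e1))) by ring.
  rewrite e0.
  assert (h1 := hq1 e1 ltac:(lra)); assert (h2 := hq1 e2 ltac:(lra)).
  assert (h3 := hq2 e1 ltac:(lra)); assert (h4 := hq2 e2 ltac:(lra)).
  assert (h5 := hq3 e1 ltac:(lra)); assert (h6 := hq3 e2 ltac:(lra)).
  rewrite Rmult_assoc; apply Rmult_le_compat_l; [lra|].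
  set (i1 := / (1 + e1)) in *; set (i2 := / (1 + e2)) in *.
  set (u1 := e1 / (1 + e1)) in *; set (u2 := e2 / (1 + e2)) in *.
  assert (u2 * i2 * i1 <= / 4 * 1) by (apply Rmult_le_compat; nra).
  assert (u1 * i1 * i2 <= / 4 * 1) by (apply Rmult_le_compat; nra).
  lra. }
set (w1 := (e1 / (1 + e1)) ^ 2) in *; set (w2 := (e2 / (1 + e2)) ^ 2) in *.
assert (2 * / q ^ 2 * (w2 - w1) <= 2 * / q ^ 2 * ((e2 - e1) / 2))
  by (apply Rmult_le_compat_l; lra).
assert (/ q ^ 2 * (e2 - e1) <= (second_coef q + first_coef q) * (e2 - e1))
  by (apply Rmult_le_compat_r; lra).
lra.
Qed.

(** The upper bound (1 + k e) (a + k b) - k w is convex in k, so it is enough to look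
    at k = 0, where it is at most 1.28, and at k = 1, which is [growth_end_le]. *)
Lemma growth_le_2 (k q s : R) : 0 < k <= 1 -> 1 < q -> 0 <= s ->
  exp s <= 88 / 100 + 87 / 100 * q ->
  growth k (/ q) (second_coef q + k * first_coef q) s <= 2.
Proof.
intros hk hq hs hX.
set (e := (exp s - 1) / 2).
assert (hx := exp_ge_1 s hs).
assert (he : 0 <= e) by (unfold e; lra).
assert (hb := first_coef_ge0 q hq).
assert (ha : 0 < second_coef q <= 2).
{ unfold second_coef; split; [apply Rmult_lt_0_compat; [lra|apply Rinv_0_lt_compat; lra]|].
  apply (Rmult_le_reg_r (q + 1)); [lra|].
  unfold Rdiv; rewrite Rmult_assoc, Rinv_l; lra. }
assert (hexp : exp (k * (ln (1 + exp s) - ln 2)) <= 1 + k * e).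
{ apply Rle_trans with (1 := exp_weighted_le k _ ltac:(lra)).
  unfold Rminus at 2; rewrite exp_plus, exp_Ropp, !exp_ln by lra.
  unfold e; lra. }
assert (hs2 : 2 * e ^ 2 / (q ^ 2 * (1 + e) ^ 2) <= (/ q) ^ 2 * s ^ 2 / 2).
{ assert (h := two_tanh_half_le s hs).
  replace (2 * (exp s - 1) / (1 + exp s)) with (2 * (e / (1 + e))) in h
    by (unfold e; field; lra).
  replace (2 * e ^ 2 / (q ^ 2 * (1 + e) ^ 2)) with ((/ q) ^ 2 * (2 * (e / (1 + e))) ^ 2 / 2)
    by (field; lra).
  assert (0 <= e / (1 + e)) by (apply Rmult_le_pos; [easy|left; apply Rinv_0_lt_compat; lra]).
  assert (0 <= (/ q) ^ 2) by apply pow2_ge_0.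
  assert ((2 * (e / (1 + e))) ^ 2 <= s ^ 2) by nra.
  assert ((/ q) ^ 2 * (2 * (e / (1 + e))) ^ 2 <= (/ q) ^ 2 * s ^ 2)
    by (apply Rmult_le_compat_l; easy).
  lra. }
assert (hend : (1 + e) * (second_coef q + first_coef q) - (/ q) ^ 2 * s ^ 2 / 2 <= 2).
{ assert (h1 := growth_end_monotone q e _ hq
    (conj he (ltac:(unfold e; lra) : e <= (87 / 100 * q - 12 / 100) / 2))).
  assert (h2 := growth_end_le q hq); cbv zeta in h2; lra. }
unfold growth.
set (a := second_coef q) in *; set (b := first_coef q) in *.
set (w := (/ q) ^ 2 * s ^ 2 / 2) in *.
replace (k * (/ q) ^ 2 * s ^ 2 / 2) with (k * w) by (unfold w; field; lra).
assert (h1 : (a + k * b) * exp (k * (ln (1 + exp s) - ln 2)) <= (a + k * b) * (1 + k * e)).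
{ apply Rmult_le_compat_l; nra. }
assert (h2 : k * ((1 + e) * (a + b) - w) <= k * 2) by (apply Rmult_le_compat_l; lra).
assert (h3 : 0 <= k * e * b * (1 - k)).
{ apply Rmult_le_pos; [apply Rmult_le_pos; [nra|lra]|lra]. }
nra.
Qed.

Lemma gap_pos (k q : R) (N M : R -> R) (s : R) :
  0 < k <= 1 -> 1 < q -> log_moments k (/ q) N M ->
  exp s <= 88 / 100 + 87 / 100 * q -> 0 < gap k (/ q) s (N s) (M s).
Proof.
intros hk hq hm hX.
assert (hr := inv_bounds q hq).
destruct (Rle_lt_dec s 0) as [hs|hs]; [now apply gap_pos_left|].
assert (hN := first_moment_pos k (/ q) N M 0 ltac:(lra) hm ltac:(lra)).
assert (hM := second_moment_lt k (/ q) N M 0 hk ltac:(lra) hm ltac:(lra)).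
assert (hNm := first_moment_0_le k (/ q) N M hk hr hm).
assert (hms := mass_pos k (/ q) 0).
assert (e1 : / q * (2558 / 1000) = second_coef q * (1 + / q)).
{ unfold second_coef; field; lra. }
assert (e2 : / q * first_bound (/ q) = first_coef q).
{ unfold first_bound, first_coef; field; repeat split; lra. }
assert (ha : 0 < second_coef q).
{ unfold second_coef; apply Rmult_lt_0_compat; [lra|apply Rinv_0_lt_compat; lra]. }
assert (h1 : / q * N 0 <= k * first_coef q * mass k (/ q) 0).
{ rewrite <- e2.
  replace (k * (/ q * first_bound (/ q)) * mass k (/ q) 0)
    with (/ q * (k * first_bound (/ q) * mass k (/ q) 0)) by ring.
  apply Rmult_le_compat_l; lra. }
apply (gap_pos_right k (/ q) (second_coef q + k * first_coef q)); try easy; try lra.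
- nra.
- assert (h2 : / q * M 0 < second_coef q * N 0).
  { apply (Rmult_lt_reg_l (1 + / q)); [lra|].
    apply Rlt_le_trans with (/ q * (2558 / 1000 * N 0)); [|nra].
    replace ((1 + / q) * (/ q * M 0)) with (/ q * ((1 + / q) * M 0)) by ring.
    apply Rmult_lt_compat_l; [lra|].
    replace (0 ^ 2 * density k (/ q) 0) with 0 in hM by ring. lra. }
  assert (h3 : / q * N 0 ^ 2 / mass k (/ q) 0 <= k * first_coef q * N 0).
  { apply (Rmult_le_reg_r (mass k (/ q) 0)); [easy|].
    unfold Rdiv; rewrite Rmult_assoc, Rinv_l by lra.
    assert (h := Rmult_le_compat_r (N 0) _ _ (Rlt_le _ _ hN) h1). nra. }
  lra.
- assert (h2 := exp_ineq1_le s).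
  apply (Rmult_le_reg_l q); [lra|].
  rewrite <- Rmult_assoc, Rinv_r by lra; lra.
- intros u hu; apply growth_le_2; try easy; try lra.
  apply Rle_trans with (2 := hX), exp_le_mono; lra.
Qed.

(** * How far the unit level reaches *)

Lemma inv_one_plus_le (w : R) : 0 < w < 1 ->
  / (1 + w) < 1 - 3 / 4 * w + / 4 * w ^ 2.
Proof.
intros hw; apply (Rmult_lt_reg_r (1 + w)); [lra|].
rewrite Rinv_l by lra.
assert (0 < w * (1 - w) ^ 2) by (apply Rmult_lt_0_compat; nra). nra.
Qed.

(** The integral over u < s of r e^((1+r) u) (1 - 3/4 e^u + 1/4 e^(2u)), a bound for
    the amount by which the area up to x = e^(r s) falls short of x. *)
Definition tail_bound (r s : R) : R :=
  r * (exp ((1 + r) * s) / (1 + r) - 3 / 4 * (exp ((2 + r) * s) / (2 + r))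
       + / 4 * (exp ((3 + r) * s) / (3 + r))).

Lemma mass_ge_logistic (k r s : R) : k <= 1 ->
  exp (r * s) * (1 - logistic s) <= mass k r s.
Proof.
intros hk; assert (h := exp_pos s).
replace (exp (r * s) * (1 - logistic s)) with (mass 1 r s).
- apply exp_le_mono.
  assert (0 <= ln (1 + exp s)) by (rewrite <- ln_1; left; apply ln_increasing; lra).
  nra.
- unfold mass, logistic, Rminus; rewrite exp_plus, exp_Ropp, Rmult_1_l, exp_ln by lra.
  field; lra.
Qed.

(** A is the arcsinh integral as a function of s = q ln x. The mass decreases in k,
    so that it is enough to integrate its value r e^(r u) / (1 + e^u) at k = 1. *)
Lemma area_left (k r : R) (A : R -> R) (s : R) : 0 < k <= 1 -> 0 < r <= 1 ->
  (forall u, is_derive A u (r * mass k r u)) -> is_lim A m_infty 0 -> s <= 0 ->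
  exp (r * s) - tail_bound r s < A s.
Proof.
intros hk hr hA hA0 hs.
enough (0 < A s - (exp (r * s) - tail_bound r s)) by lra.
apply (pos_of_lim_m_infty (fun s => A s - (exp (r * s) - tail_bound r s))
  (fun s => r * (mass k r s - exp (r * s)
    * (1 - exp s * (1 - 3 / 4 * exp s + / 4 * exp s ^ 2))))).
- intros u _; evar_last.
  + apply @is_derive_minus; [apply hA|].
    apply (is_derive_ext (fun s => exp (r * s) - tail_bound r s)); [easy|].
    unfold tail_bound; auto_derive; [easy|reflexivity].
  + unfold minus, plus, opp; simpl.
    replace ((1 + r) * u) with (r * u + u) by ring.
    replace ((2 + r) * u) with (r * u + u + u) by ring.
    replace ((3 + r) * u) with (r * u + u + u + u) by ring.
    rewrite !exp_plus; field; lra.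
- intros u hu.
  assert (hw : 0 < exp u < 1).
  { split; [apply exp_pos|]; rewrite <- exp_0; apply exp_increasing; lra. }
  assert (h := mass_ge_logistic k r u ltac:(lra)).
  assert (h1 := inv_one_plus_le _ hw); assert (h2 := exp_pos (r * u)).
  assert (h3 : 1 - exp u * (1 - 3 / 4 * exp u + / 4 * exp u ^ 2) < 1 - logistic u).
  { unfold logistic, Rdiv.
    assert (exp u * / (1 + exp u) < exp u * (1 - 3 / 4 * exp u + / 4 * exp u ^ 2))
      by (apply Rmult_lt_compat_l; lra). lra. }
  apply Rmult_lt_0_compat; [lra|].
  assert (h4 := Rmult_lt_compat_l _ _ _ h2 h3). lra.
- assert (hl : forall c a, 0 < c -> is_lim (fun u => a * (exp (c * u) / c)) m_infty 0).
  { intros c a hc; evar_last.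
    - apply is_lim_scal_l; unfold Rdiv; apply is_lim_scal_r, is_lim_exp_scal, hc.
    - simpl; f_equal; ring. }
  evar_last.
  { apply (is_lim_minus _ _ _ 0 (0 - r * (0 - 0 + 0))); [exact hA0| |easy].
    apply (is_lim_minus _ _ _ 0 (r * (0 - 0 + 0))); [apply is_lim_exp_scal; lra| |easy].
    evar_last.
    { apply is_lim_scal_l, (is_lim_plus _ _ _ (0 - 0) 0); [|apply hl; lra|easy].
      apply (is_lim_minus _ _ _ 0 0); [|apply hl; lra|easy].
      apply (is_lim_ext (fun u => 1 * (exp ((1 + r) * u) / (1 + r)))).
      - intros u; ring.
      - apply hl; lra. }
    easy. }
  simpl; f_equal; ring.
Qed.

(** A rational minorant of 2 int_0^s u / (1 + e^u) du in terms of h = e^s - 1. The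
    expansion at h = 0 fixes the coefficients 6 and 8; 2.46 is close to the least
    value for which the derivatives compare for all h >= 0. *)
Definition odd_gain (h : R) : R := 3 * h ^ 2 / (6 + 8 * h + 123 / 50 * h ^ 2).

(** Pairing u with - u, the minorant e^(r u) / (1 + e^u) of the mass contributes
    e^(- r u) + (e^(r u) - e^(- r u)) / (1 + e^u). After multiplication by r the first
    term integrates to 1 - e^(- r s), and the second is at least
    2 r^2 u / (1 + e^u). *)
Lemma area_right (k r : R) (A : R -> R) (s : R) : 0 < k <= 1 -> 0 < r <= 1 ->
  (forall u, is_derive A u (r * mass k r u)) -> 0 <= s ->
  1 - exp (- r * s) + r ^ 2 * odd_gain (exp s - 1) <= A s - A (- s).
Proof.
intros hk hr hA hs.
set (F := fun s => A s - A (- s) + exp (- r * s) - r ^ 2 * odd_gain (exp s - 1)).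
enough (h : F 0 <= F s).
{ unfold F in h; rewrite Ropp_0, Rmult_0_r, exp_0 in h.
  replace (odd_gain (1 - 1)) with 0 in h by (unfold odd_gain; field; lra). lra. }
(* The last term is the derivative of odd_gain (e^s - 1). *)
apply (monotone_of_derive F (fun s => r * mass k r s + r * mass k r (- s)
  - r * exp (- r * s) - r ^ 2 * (exp s * ((36 * (exp s - 1) + 24 * (exp s - 1) ^ 2)
      / (6 + 8 * (exp s - 1) + 123 / 50 * (exp s - 1) ^ 2) ^ 2)))); [easy| |].
- intros u hu; unfold F.
  assert (xA : forall v, ex_derive A v) by (intros v; eexists; apply hA).
  assert (dA := fun v => is_derive_unique _ _ _ (hA v)).
  assert (hx := exp_ge_1 u ltac:(lra)).
  set (m := mass k r) in *; clearbody m.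
  unfold odd_gain; auto_derive.
  + repeat split; try apply xA. nra.
  + change (Derive (fun x => A x) u) with (Derive A u).
    change (Derive (fun x => A x) (- u)) with (Derive A (- u)).
    rewrite !dA; field. nra.
- intros u hu.
  assert (hx := exp_ge_1 u ltac:(lra)).
  set (X := exp u) in *.
  assert (h1 := mass_ge_logistic k r u ltac:(lra)).
  assert (h2 := mass_ge_logistic k r (- u) ltac:(lra)).
  assert (e1 : 1 - logistic (- u) = X / (1 + X)).
  { unfold logistic; rewrite exp_Ropp; fold X; field; lra. }
  assert (e2 : 1 - logistic u = / (1 + X)).
  { unfold logistic; fold X; field; lra. }
  rewrite e1 in h2; rewrite e2 in h1.
  replace (r * - u) with (- r * u) in h2 by ring.
  assert (h3 : 2 * r * u <= exp (r * u) - exp (- r * u)).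
  { assert (h : 0 * 0 <= exp (r * u) - exp (- r * u) - 2 * r * u); [|lra].
    replace (0 * 0) with (exp (r * 0) - exp (- r * 0) - 2 * r * 0)
      by (rewrite !Rmult_0_r, exp_0; ring).
    apply (monotone_of_derive (fun t => exp (r * t) - exp (- r * t) - 2 * r * t)
      (fun t => r * (exp (r * t) + exp (- r * t) - 2))); [lra| |].
    - intros t _; auto_derive; [easy|ring].
    - intros t _; apply Rmult_le_pos; [lra|].
      assert (ha := exp_ineq1_le (r * t)); assert (hb := exp_ineq1_le (- r * t)); lra. }
  assert (h4 := two_tanh_half_le u ltac:(lra)); fold X in h4.
  set (h := X - 1) in *; replace X with (1 + h) in * by (unfold h; ring).
  assert (hh : 0 <= h) by lra.
  assert (hi : 0 < / (1 + (1 + h))) by (apply Rinv_0_lt_compat; lra).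
  assert (hD : 0 < 6 + 8 * h + 123 / 50 * h ^ 2) by nra.
  (* The minorant u >= 2 h / (2 + h), with h = e^u - 1, reduces the comparison to
     polynomials. *)
  assert (h5 : (1 + h) * ((36 * h + 24 * h ^ 2) / (6 + 8 * h + 123 / 50 * h ^ 2) ^ 2)
    <= 2 * (2 * h / (1 + (1 + h))) * / (1 + (1 + h))).
  { apply (Rmult_le_reg_r ((6 + 8 * h + 123 / 50 * h ^ 2) ^ 2 * (2 + h) ^ 2)).
    - apply Rmult_lt_0_compat; nra.
    - replace (_ * _) with (h * ((36 + 24 * h) * (1 + h) * (2 + h) ^ 2)) by (field; lra).
      replace (2 * (2 * h / (1 + (1 + h))) * / (1 + (1 + h)) *
        ((6 + 8 * h + 123 / 50 * h ^ 2) ^ 2 * (2 + h) ^ 2))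
      with (h * (4 * (6 + 8 * h + 123 / 50 * h ^ 2) ^ 2)) by (field; lra).
      apply Rmult_le_compat_l; [easy|].
      assert (0 <= h ^ 2) by nra. assert (0 <= h ^ 3) by (apply pow_le; lra).
      assert (0 <= h ^ 4) by (apply pow_le; lra). nra. }
  set (d := (1 + h) * _) in *.
  set (i := / (1 + (1 + h))) in *.
  replace ((1 + h) / (1 + (1 + h))) with (1 - i) in h2 by (unfold i; field; lra).
  assert (h6 : 2 * r * u * i <= (exp (r * u) - exp (- r * u)) * i)
    by (apply Rmult_le_compat_r; lra).
  assert (h7 : d <= 2 * u * i).
  { apply Rle_trans with (1 := h5).
    replace (2 * h / (1 + (1 + h))) with (2 * (1 + h - 1) / (1 + (1 + h))) by (f_equal; ring).
    apply Rmult_le_compat_r; lra. }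
  assert (h8 : r * d <= mass k r u + mass k r (- u) - exp (- r * u)).
  { apply Rle_trans with (r * (2 * u * i)); [apply Rmult_le_compat_l; lra|]. lra. }
  assert (h9 := Rmult_le_compat_l r _ _ ltac:(lra) h8). lra.
Qed.

(** The left-hand side bounds q times [tail_bound] at - ln X, by way of
    X^(-1/q) <= 1 - 1/q + 1/(q X). Over a common denominator the difference of the
    two sides is a polynomial in q - 1 with positive coefficients. The constants 0.88 and
    0.87 leave room both here, where the threshold must be large, and in
    [growth_end_le], where it must be small. *)
Lemma threshold_ineq (q : R) : 1 < q -> let X := 88 / 100 + 87 / 100 * q in
  (1 - / q + / q * / X) * / X * (/ (1 + / q) - 3 / 4 * / X / (2 + / q)
     + / 4 * (/ X) ^ 2 / (3 + / q)) <= / q * odd_gain (X - 1).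
Proof.
intros hq X.
assert (hX : 0 < X) by (unfold X; lra).
unfold odd_gain.
set (h := X - 1).
assert (hh : 0 < h) by (unfold h, X; lra).
assert (hD : 0 < 6 + 8 * h + 123 / 50 * h ^ 2) by nra.
set (z := q - 1).
assert (hz : 0 <= z) by (unfold z; lra).
enough (e : / q * (3 * h ^ 2 / (6 + 8 * h + 123 / 50 * h ^ 2)) -
  (1 - / q + / q * / X) * / X * (/ (1 + / q) - 3 / 4 * / X / (2 + / q)
     + / 4 * (/ X) ^ 2 / (3 + / q)) =
  (8446640625000 + z * (97326316406250 + z * (312175540453125
  + z * (478744805542500 + z * (416734545890925 + z * (224869432701000
  + z * (81789994182159 + z * (22109019602004 + z * (4377338768727
  + z * 448578828630))))))))) / 1000000000000 /
  (q * (6 + 8 * h + 123 / 50 * h ^ 2) * (q + 1) * (2 * q + 1) * (3 * q + 1) * X ^ 4)).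
{ enough (0 <= (8446640625000 + z * (97326316406250 + z * (312175540453125
  + z * (478744805542500 + z * (416734545890925 + z * (224869432701000
  + z * (81789994182159 + z * (22109019602004 + z * (4377338768727
  + z * 448578828630))))))))) / 1000000000000 /
  (q * (6 + 8 * h + 123 / 50 * h ^ 2) * (q + 1) * (2 * q + 1) * (3 * q + 1) * X ^ 4)) by lra.
  apply Rmult_le_pos.
  - apply Rmult_le_pos; [horner_pos|lra].
  - left; apply Rinv_0_lt_compat.
    assert (0 < X ^ 4) by (apply pow_lt; lra).
    repeat apply Rmult_lt_0_compat; lra. }
unfold z, h, X in *; field; repeat split; lra.
Qed.

(** At the threshold the two area estimates add up to more than 1. *)
Lemma area_threshold (k q : R) (A : R -> R) (s : R) : 0 < k <= 1 -> 1 < q ->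
  (forall u, is_derive A u (/ q * mass k (/ q) u)) -> is_lim A m_infty 0 ->
  A s <= 1 -> exp s <= 88 / 100 + 87 / 100 * q.
Proof.
intros hk hq hA hA0 hs.
set (X := 88 / 100 + 87 / 100 * q).
assert (hX : 1 < X) by (unfold X; lra).
assert (hr := inv_bounds q hq).
destruct (Rle_lt_dec (exp s) X) as [h|h]; [easy|exfalso].
assert (hln : 0 < ln X) by (rewrite <- ln_1; apply ln_increasing; lra).
assert (hlt : ln X < s) by (rewrite <- (ln_exp s); apply ln_increasing; lra).
assert (hinc : A (ln X) < A s).
{ apply (strict_monotone_of_derive A (fun u => / q * mass k (/ q) u)); [easy| |].
  - intros u _; apply hA.
  - intros u _; apply Rmult_lt_0_compat; [lra|apply mass_pos]. }
assert (h1 := area_left k (/ q) A (- ln X) hk hr hA hA0 ltac:(lra)).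
assert (h2 := area_right k (/ q) A (ln X) hk hr hA ltac:(lra)).
rewrite exp_ln in h2 by lra.
replace (/ q * - ln X) with (- / q * ln X) in h1 by ring.
enough (h3 : tail_bound (/ q) (- ln X) <= (/ q) ^ 2 * odd_gain (X - 1)) by lra.
assert (ht := threshold_ineq q hq); cbv zeta in ht; fold X in ht.
assert (he : exp (/ q * - ln X) <= 1 - / q + / q * / X).
{ rewrite <- (exp_ln X) at 2 by lra; rewrite <- exp_Ropp; apply exp_weighted_le; lra. }
assert (heX : exp (- ln X) = / X) by (rewrite exp_Ropp, exp_ln; lra).
assert (hiX : 0 < / X < 1).
{ split; [apply Rinv_0_lt_compat; lra|].
  rewrite <- Rinv_1; apply Rinv_lt_contravar; lra. }
unfold tail_bound.
replace ((1 + / q) * - ln X) with (/ q * - ln X + - ln X) by ring.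
replace ((2 + / q) * - ln X) with (/ q * - ln X + - ln X + - ln X) by ring.
replace ((3 + / q) * - ln X) with (/ q * - ln X + - ln X + - ln X + - ln X) by ring.
rewrite !(exp_plus _ (- ln X)), heX.
set (E := exp (/ q * - ln X)) in *; set (i := / X) in *.
replace (/ q * _) with (/ q * (E * (i * (/ (1 + / q) - 3 / 4 * i / (2 + / q)
   + / 4 * i ^ 2 / (3 + / q))))) by (field; lra).
replace ((/ q) ^ 2 * odd_gain (X - 1)) with (/ q * (/ q * odd_gain (X - 1))) by ring.
apply Rmult_le_compat_l; [lra|].
apply Rle_trans with (2 := ht).
rewrite (Rmult_assoc _ i).
apply Rmult_le_compat_r; [|easy].
apply Rmult_le_pos; [lra|].
assert (h4 : / (2 + / q) <= / (1 + / q)) by (apply Rinv_le_contravar; lra).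
assert (h5 : 0 < / (2 + / q)) by (apply Rinv_0_lt_compat; lra).
assert (h6 : 0 < / (3 + / q)) by (apply Rinv_0_lt_compat; lra).
unfold Rdiv.
assert (0 <= i ^ 2 * / (3 + / q)) by (apply Rmult_le_pos; nra).
assert (i * / (2 + / q) <= 1 * / (2 + / q)) by (apply Rmult_le_compat_r; lra).
lra.
Qed.

(** * Differentiation under the integral sign *)

Lemma powp_pos (t q : R) : 0 < t -> powp t q = exp (q * ln t).
Proof. intros ht; unfold powp; destruct (Rlt_dec 0 t); [easy|lra]. Qed.

Lemma powp_nonpos (t q : R) : t <= 0 -> powp t q = 0.
Proof. intros ht; unfold powp; destruct (Rlt_dec 0 t); [lra|easy]. Qed.

(** This makes t^q (ln t)^j at most 16 sqrt t near t = 0, uniformly in q >= 1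
    (take l = - ln t). *)
Lemma exp_mul_pow_le (l : R) (j : nat) : 0 <= l -> (j <= 2)%nat ->
  exp (- l) * l ^ j <= 16 * exp (- (l / 2)).
Proof.
intros hl hj.
assert (h := exp_ineq1_le (l / 4)).
assert (e : exp (- (l / 2)) = exp (- l) * (exp (l / 4) * exp (l / 4))).
{ rewrite <- !exp_plus; f_equal; field. }
rewrite e.
replace (16 * (exp (- l) * (exp (l / 4) * exp (l / 4))))
  with (exp (- l) * (16 * (exp (l / 4) * exp (l / 4)))) by ring.
apply Rmult_le_compat_l; [left; apply exp_pos|].
assert (h2 : (1 + l) ^ 2 <= 16 * (exp (l / 4) * exp (l / 4))) by nra.
apply Rle_trans with (2 := h2).
destruct j as [|[|[|j]]]; [| | |lia]; simpl; nra.
Qed.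

Lemma continuity_2d_powp_ln (j : nat) (q t : R) : (j <= 2)%nat -> 1 < q ->
  continuity_2d_pt (fun u v => powp v u * ln v ^ j) q t.
Proof.
intros hj hq.
destruct (Rtotal_order t 0) as [ht|[->|ht]].
- apply (continuity_2d_pt_ext_loc (fun _ _ => 0)); [|apply continuity_2d_pt_const].
  exists (mkposreal (- t) ltac:(lra)); intros u v _ hv; simpl in hv.
  apply Rabs_lt_between' in hv; rewrite powp_nonpos by lra; ring.
- intros eps.
  assert (hd : 0 < Rmin (q - 1) (Rmin 1 (exp (2 * ln (eps / 16))))).
  { repeat apply Rmin_glb_lt; [lra|lra|apply exp_pos]. }
  exists (mkposreal _ hd); intros u v hu hv; simpl in hu, hv.
  assert (hu1 := Rlt_le_trans _ _ _ hu (Rmin_l _ _)).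
  assert (hv' := Rlt_le_trans _ _ _ hv (Rmin_r _ _)).
  assert (hv1 := Rlt_le_trans _ _ _ hv' (Rmin_l _ _)).
  assert (hv2 := Rlt_le_trans _ _ _ hv' (Rmin_r _ _)).
  apply Rabs_lt_between' in hu1; rewrite Rminus_0_r in hv1, hv2.
  rewrite (powp_nonpos 0) by lra; rewrite Rmult_0_l, Rminus_0_r.
  assert (heps := cond_pos eps).
  destruct (Rle_lt_dec v 0) as [hv0|hv0].
  { rewrite powp_nonpos by easy; now rewrite Rmult_0_l, Rabs_R0. }
  rewrite Rabs_pos_eq in hv1, hv2 by lra.
  rewrite powp_pos by easy.
  assert (hl : ln v < 0) by (rewrite <- ln_1; now apply ln_increasing).
  assert (hl2 : ln v < 2 * ln (eps / 16)).
  { apply exp_lt_inv; now rewrite exp_ln. }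
  rewrite Rabs_mult, (Rabs_pos_eq (exp _)) by (left; apply exp_pos).
  rewrite <- RPow_abs, (Rabs_left (ln v)) by easy.
  apply Rle_lt_trans with (exp (- - ln v) * (- ln v) ^ j).
  { apply Rmult_le_compat_r; [apply pow_le; lra|].
    apply exp_le_mono; nra. }
  apply Rle_lt_trans with (1 := exp_mul_pow_le (- ln v) j ltac:(lra) hj).
  apply Rlt_le_trans with (16 * exp (ln (eps / 16))).
  + apply Rmult_lt_compat_l; [lra|]; apply exp_increasing; lra.
  + rewrite exp_ln by lra; lra.
- apply (continuity_2d_pt_ext_loc (fun u v => exp (u * ln v) * ln v ^ j)).
  + exists (mkposreal t ht); intros u v _ hv; simpl in hv.
    apply Rabs_lt_between' in hv; rewrite powp_pos by lra; easy.
  + assert (hln : continuity_2d_pt (fun _ v => ln v) q t).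
    { apply (continuity_1d_2d_pt_comp ln); [|apply continuity_2d_pt_id2].
      apply continuity_pt_filterlim, (ex_derive_continuous ln); auto_derive; lra. }
    apply continuity_2d_pt_mult.
    * apply (continuity_1d_2d_pt_comp exp).
      -- apply derivable_continuous_pt, derivable_pt_exp.
      -- apply continuity_2d_pt_mult; [apply continuity_2d_pt_id1|easy].
    * apply (continuity_1d_2d_pt_comp (fun l => l ^ j)); [|easy].
      apply derivable_continuous_pt, derivable_pt_pow.
Qed.

Lemma continuity_2d_powp (q t : R) : 1 < q ->
  continuity_2d_pt (fun u v => powp v u) q t.
Proof.
intros hq; apply (continuity_2d_pt_ext (fun u v => powp v u * ln v ^ 0)).
- intros; simpl; ring.
- apply continuity_2d_powp_ln; [lia|easy].
Qed.

Lemma continuity_2d_inv_Rpower (c q t : R) : 1 < q ->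
  continuity_2d_pt (fun u v => / Rpower (1 + powp v u) c) q t.
Proof.
intros hq; apply (continuity_1d_2d_pt_comp (fun w => / Rpower (1 + w) c)).
- assert (h := powp_ge0 t q).
  apply continuity_pt_filterlim, (ex_derive_continuous (fun w => / Rpower (1 + w) c)).
  unfold Rpower; auto_derive; split; [lra|].
  split; [|easy]; apply Rgt_not_eq, exp_pos.
- now apply continuity_2d_powp.
Qed.

Lemma continuity_2d_alpha1 (p q t : R) : 1 < q ->
  continuity_2d_pt (alpha1 p) q t.
Proof.
intros hq; apply (continuity_2d_pt_ext (fun u v =>
  - (powp v u * ln v ^ 1 * / Rpower (1 + powp v u) (1 + / p)))).
{ intros u v; unfold alpha1, Rdiv; ring. }
apply continuity_2d_pt_opp, continuity_2d_pt_mult.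
- apply continuity_2d_powp_ln; [lia|easy].
- now apply continuity_2d_inv_Rpower.
Qed.

Lemma continuity_2d_alpha2 (p q t : R) : 1 < q ->
  continuity_2d_pt (alpha2 p) q t.
Proof.
intros hq; apply (continuity_2d_pt_ext (fun u v =>
  powp v u * ln v ^ 2 * (powp v u - p) * / Rpower (1 + powp v u) (2 + / p))).
{ intros u v; unfold alpha2, Rdiv; ring. }
apply continuity_2d_pt_mult; [apply continuity_2d_pt_mult|].
- apply continuity_2d_powp_ln; [lia|easy].
- apply continuity_2d_pt_minus; [now apply continuity_2d_powp|apply continuity_2d_pt_const].
- now apply continuity_2d_inv_Rpower.
Qed.

Lemma continuous_of_2d (f : R -> R -> R) (q t : R) :
  continuity_2d_pt f q t -> continuous (f q) t.
Proof.
intros h; apply continuity_pt_filterlim; intros eps heps.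
destruct (h (mkposreal eps heps)) as [d hd].
exists d; split; [apply cond_pos|]; intros v [_ hv]; simpl in *.
apply hd; [|easy]. rewrite Rminus_diag_eq, Rabs_R0 by easy; apply cond_pos.
Qed.

(** Leibniz' rule with a moving upper limit, for a parameter in (1, oo). *)
Lemma is_derive_RInt_moving (f df : R -> R -> R) (b : R -> R) (q db : R) :
  (forall u t, 1 < u -> is_derive (fun z => f z t) u (df u t)) ->
  (forall u t, 1 < u -> continuous (f u) t) ->
  (forall u t, 1 < u -> continuity_2d_pt df u t) ->
  1 < q -> is_derive b q db ->
  is_derive (fun u => RInt (f u) 0 (b u)) q (RInt (df q) 0 (b q) + f q (b q) * db).
Proof.
intros hd hc h2 hq hb.
assert (hloc : locally q (fun u => 1 < u)).
{ exists (mkposreal (q - 1) ltac:(lra)); intros u hu.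
  apply Rabs_lt_between' in hu; simpl in hu; lra. }
assert (hex : forall a c, locally q (fun u => ex_RInt (fun t => f u t) a c)).
{ intros a c; revert hloc; apply filter_imp; intros u hu.
  apply @ex_RInt_continuous; intros t _; now apply hc. }
assert (hD : forall u t, 1 < u -> Derive (fun z => f z t) u = df u t).
{ intros u t hu; apply is_derive_unique; now apply hd. }
assert (h2D : forall u t, 1 < u ->
  continuity_2d_pt (fun u v => Derive (fun z => f z v) u) u t).
{ intros u t hu; apply (continuity_2d_pt_ext_loc df); [|now apply h2].
  exists (mkposreal (u - 1) ltac:(lra)); intros w v hw _; simpl in hw.
  apply Rabs_lt_between' in hw; symmetry; apply hD; lra. }
replace (RInt (df q) 0 (b q)) with (RInt (fun t => Derive (fun u => f u t) q) 0 (b q)).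
2: { apply RInt_ext; intros t _; now apply hD. }
apply (is_derive_RInt_param_bound_comp_aux3 f 0 b q db).
- apply hex.
- exists (mkposreal 1 Rlt_0_1); apply hex.
- easy.
- exists (mkposreal 1 Rlt_0_1); revert hloc; apply filter_imp; intros u hu t _.
  eexists; now apply hd.
- intros t _; now apply h2D.
- exists (mkposreal (q - 1) ltac:(lra)); intros u v hu _; simpl in hu.
  apply Rabs_lt_between' in hu; apply h2D; lra.
- apply continuity_pt_filterlim; now apply hc.
Qed.

Lemma is_derive_integrand (p q t : R) :
  is_derive (fun z => Rpower (1 + powp t z) (- / p)) q (/ p * alpha1 p q t).
Proof.
destruct (Rle_lt_dec t 0) as [ht|ht].
- apply (is_derive_ext (fun _ => Rpower (1 + 0) (- / p))).
  { intros z; now rewrite powp_nonpos. }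
  unfold alpha1; rewrite powp_nonpos by easy.
  evar_last; [apply @is_derive_const|unfold zero; simpl; unfold Rdiv; ring].
- apply (is_derive_ext (fun z => Rpower (1 + exp (z * ln t)) (- / p))).
  { intros z; now rewrite powp_pos. }
  unfold alpha1; rewrite powp_pos by easy.
  assert (h := exp_pos (q * ln t)).
  unfold Rpower; auto_derive; [lra|].
  replace ((1 + / p) * ln (1 + exp (q * ln t)))
    with (ln (1 + exp (q * ln t)) + / p * ln (1 + exp (q * ln t))) by ring.
  replace (- / p * ln (1 + exp (q * ln t))) with (- (/ p * ln (1 + exp (q * ln t)))) by ring.
  rewrite exp_Ropp, exp_plus, exp_ln by lra.
  assert (h1 := exp_pos (/ p * ln (1 + exp (q * ln t)))).
  set (w := / p) in *; clearbody w; field; lra.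
Qed.

Lemma is_derive_alpha1 (p q t : R) : p <> 0 ->
  is_derive (fun z => alpha1 p z t) q (/ p * alpha2 p q t).
Proof.
intros hp; unfold alpha1, alpha2.
destruct (Rle_lt_dec t 0) as [ht|ht].
- apply (is_derive_ext (fun _ => 0)).
  { intros z; rewrite powp_nonpos by easy.
    change (0 = - (0 * ln t / Rpower (1 + 0) (1 + / p))).
    unfold Rdiv; ring. }
  rewrite powp_nonpos by easy.
  evar_last; [apply @is_derive_const|unfold zero; simpl; unfold Rdiv; ring].
- apply (is_derive_ext (fun z =>
    - (exp (z * ln t) * ln t / Rpower (1 + exp (z * ln t)) (1 + / p)))).
  { intros z; now rewrite powp_pos. }
  rewrite powp_pos by easy.
  assert (h := exp_pos (q * ln t)).
  unfold Rpower; auto_derive.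
  { split; [lra|]; split; [|easy]; apply Rgt_not_eq, exp_pos. }
  replace ((1 + / p) * ln (1 + exp (q * ln t)))
    with (ln (1 + exp (q * ln t)) + / p * ln (1 + exp (q * ln t))) by ring.
  replace ((2 + / p) * ln (1 + exp (q * ln t)))
    with (ln (1 + exp (q * ln t)) + ln (1 + exp (q * ln t))
          + / p * ln (1 + exp (q * ln t))) by ring.
  rewrite !exp_plus, exp_ln by lra.
  assert (h1 := exp_pos (/ p * ln (1 + exp (q * ln t)))).
  set (E := exp (/ p * ln (1 + exp (q * ln t)))) in *; clearbody E.
  field; lra.
Qed.

(** * The criterion in moments *)

Lemma powp_exp (q s : R) : 0 < q -> powp (exp (/ q * s)) q = exp s.
Proof.
intros hq; rewrite powp_pos by apply exp_pos.
rewrite ln_exp; f_equal; field; lra.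
Qed.

Lemma is_derive_RInt_exp (f : R -> R) (q s : R) : 0 < q ->
  (forall t, continuous f t) ->
  is_derive (fun s => RInt f 0 (exp (/ q * s))) s
    (f (exp (/ q * s)) * (exp (/ q * s) / q)).
Proof.
intros hq hf.
evar_last.
- apply (is_derive_comp (fun x => RInt f 0 x) (fun s => exp (/ q * s))).
  + apply (is_derive_RInt f (fun x => RInt f 0 x) 0); [|apply hf].
    apply filter_forall; intros y; apply @RInt_correct, ex_RInt_continuous; auto.
  + auto_derive; [easy|reflexivity].
- unfold scal; simpl; unfold mult; simpl; field; lra.
Qed.

Lemma is_lim_RInt_exp (f : R -> R) (q : R) : 0 < q ->
  (forall t, continuous f t) ->
  is_lim (fun s => RInt f 0 (exp (/ q * s))) m_infty 0.
Proof.
intros hq hf.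
assert (hc : continuous (fun x => RInt f 0 x) 0).
{ apply (@ex_derive_continuous R_AbsRing R_NormedModule); exists (f 0).
  apply (is_derive_RInt f (fun x => RInt f 0 x) 0); [|apply hf].
  apply filter_forall; intros y; apply @RInt_correct, ex_RInt_continuous; auto. }
evar_last.
- apply (is_lim_comp_continuous (fun s => exp (/ q * s)) (fun x => RInt f 0 x) _ 0); [|easy].
  apply is_lim_exp_scal, Rinv_0_lt_compat, hq.
- now rewrite RInt_point.
Qed.

Lemma continuous_alpha1 (p q t : R) : 1 < q -> continuous (alpha1 p q) t.
Proof. intros hq; now apply continuous_of_2d, continuity_2d_alpha1. Qed.

Lemma continuous_alpha2 (p q t : R) : 1 < q -> continuous (alpha2 p q) t.
Proof. intros hq; now apply continuous_of_2d, continuity_2d_alpha2. Qed.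

(** The first moment: the substitution t = e^(s/q) turns alpha1 into
    - s density up to the factor p / q^2. *)
Definition moment1 (p q s : R) : R := / p * q ^ 2 * RInt (alpha1 p q) 0 (exp (/ q * s)).

(** The second moment solved from s^2 density + 2 N - r M =
    int u^2 (1 - (1 + k) logistic) density, whose right-hand side is a multiple of
    the integral of alpha2. In this form no further integral is needed. *)
Definition moment2 (p q s : R) : R :=
  q * (s ^ 2 * density (/ p) (/ q) s + 2 * moment1 p q s
       + (/ p) ^ 2 * q ^ 3 * RInt (alpha2 p q) 0 (exp (/ q * s))).

Lemma Rpower_one_plus_exp (k c s : R) :
  Rpower (1 + exp s) (c + k) = Rpower (1 + exp s) c * exp (k * ln (1 + exp s)).
Proof. now rewrite Rpower_plus. Qed.

Lemma mass_eq (k r s : R) : mass k r s = exp (r * s) / exp (k * ln (1 + exp s)).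
Proof.
unfold mass, Rminus, Rdiv; now rewrite exp_plus, exp_Ropp.
Qed.

Lemma is_derive_moment1 (p q s : R) : 1 < p -> 1 < q ->
  is_derive (moment1 p q) s (- s * density (/ p) (/ q) s).
Proof.
intros hp hq; unfold moment1; evar_last.
- apply is_derive_scal, is_derive_RInt_exp; [lra|]; intros t; now apply continuous_alpha1.
- unfold alpha1, density, logistic; rewrite powp_exp, mass_eq, Rpower_one_plus_exp, ln_exp by lra.
  assert (h := exp_pos s); rewrite Rpower_1 by lra.
  assert (h1 := exp_pos (/ p * ln (1 + exp s))).
  set (E := exp (/ p * ln (1 + exp s))) in *; clearbody E.
  field; lra.
Qed.

Lemma log_moments_integrals (p q : R) : 1 < p -> 1 < q ->
  log_moments (/ p) (/ q) (moment1 p q) (moment2 p q).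
Proof.
intros hp hq.
assert (hk := inv_bounds p hp); assert (hr := inv_bounds q hq).
assert (l1 : is_lim (moment1 p q) m_infty 0).
{ unfold moment1; evar_last.
  - apply is_lim_scal_l, is_lim_RInt_exp; [lra|]; intros t; now apply continuous_alpha1.
  - simpl; f_equal; ring. }
split; [|split; [|split]].
- intros s; now apply is_derive_moment1.
- exact l1.
- intros s; unfold moment2; evar_last.
  + apply is_derive_scal, @is_derive_plus; [apply @is_derive_plus|].
    * apply (is_derive_mult (fun s => s ^ 2) (density (/ p) (/ q)) s (2 * s)).
      -- auto_derive; [easy|ring].
      -- apply is_derive_density.
      -- exact Rmult_comm.
    * apply is_derive_scal; now apply is_derive_moment1.
    * apply is_derive_scal, is_derive_RInt_exp; [lra|].
      intros t; now apply continuous_alpha2.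
  + unfold plus, mult; simpl.
    unfold alpha2, density, logistic; rewrite powp_exp, mass_eq, Rpower_one_plus_exp, ln_exp by lra.
    assert (h := exp_pos s).
    replace 2 with (1 + 1) at 3 by ring; rewrite Rpower_plus, Rpower_1 by lra.
    assert (h1 := exp_pos (/ p * ln (1 + exp s))).
    set (E := exp (/ p * ln (1 + exp s))) in *; clearbody E.
    field; lra.
- assert (h1 := is_lim_sqr_density (/ p) (/ q) hk ltac:(lra)).
  unfold moment2; evar_last.
  { apply is_lim_scal_l, (is_lim_plus _ _ _ (0 + 2 * 0) ((/ p) ^ 2 * q ^ 3 * 0)).
    - apply (is_lim_plus _ _ _ 0 (2 * 0)); [exact h1| |easy].
      evar_last; [apply is_lim_scal_l, l1|easy].
    - evar_last; [apply is_lim_scal_l, is_lim_RInt_exp; [lra|]|easy].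
      intros t; now apply continuous_alpha2.
    - easy. }
  simpl; f_equal; ring.
Qed.

Lemma criterion_eq_gap (p q s : R) : 1 < p -> 1 < q ->
  criterion p q (exp (/ q * s))
  = - (p ^ 2 / q ^ 3 * gap (/ p) (/ q) s (moment1 p q s) (moment2 p q s)).
Proof.
intros hp hq; unfold criterion, gap, moment2.
set (A2 := RInt (alpha2 p q) 0 (exp (/ q * s))).
replace (RInt (alpha1 p q) 0 (exp (/ q * s))) with (p / q ^ 2 * moment1 p q s)
  by (unfold moment1; field; lra).
set (N := moment1 p q s).
unfold density, logistic; rewrite powp_exp, mass_eq, ln_exp by lra.
assert (h := exp_pos s).
replace (1 - / p) with (1 + - / p) by ring.
rewrite Rpower_one_plus_exp, Rpower_1 by lra.
rewrite Ropp_mult_distr_l_reverse, exp_Ropp.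
assert (h1 := exp_pos (/ p * ln (1 + exp s))).
assert (h2 := exp_pos (/ q * s)).
set (E := exp (/ p * ln (1 + exp s))) in *; clearbody E.
set (x := exp (/ q * s)) in *; clearbody x A2 N.
set (X := exp s) in *; clearbody X.
field; repeat split; lra.
Qed.

Lemma is_derive_arcsinh_exp (p q s : R) : 1 < q ->
  is_derive (fun s => arcsinh_pq p q (exp (/ q * s))) s (/ q * mass (/ p) (/ q) s).
Proof.
intros hq; unfold arcsinh_pq; evar_last.
- apply is_derive_RInt_exp; [lra|]; intros t; apply continuous_arcsinh_integrand; lra.
- cbv beta; rewrite powp_exp, mass_eq by lra; unfold Rpower.
  rewrite Ropp_mult_distr_l_reverse, exp_Ropp; unfold Rdiv; ring.
Qed.

Lemma arcsinh_le_1_threshold (p q s : R) : 1 < p -> 1 < q ->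
  arcsinh_pq p q (exp (/ q * s)) <= 1 -> exp s <= 88 / 100 + 87 / 100 * q.
Proof.
intros hp hq hs.
apply (area_threshold (/ p) q (fun s => arcsinh_pq p q (exp (/ q * s)))); try easy.
- now apply inv_bounds.
- intros u; now apply is_derive_arcsinh_exp.
- apply is_lim_RInt_exp; [lra|]; intros t; apply continuous_arcsinh_integrand; lra.
Qed.

(** The condition on the arcsinh integral keeps x^q below the threshold up to which
    the barrier works. *)
Lemma criterion_neg (p q x : R) : 1 < p -> 1 < q -> 0 < x ->
  arcsinh_pq p q x <= 1 -> criterion p q x < 0.
Proof.
intros hp hq hx hle.
assert (e : x = exp (/ q * (q * ln x))).
{ rewrite <- Rmult_assoc, Rinv_l, Rmult_1_l, exp_ln; lra. }
rewrite e in hle |- *; set (s := q * ln x) in *; clearbody s; clear e hx.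
rewrite criterion_eq_gap by easy.
assert (hg := gap_pos (/ p) q _ _ s (inv_bounds p hp) hq
  (log_moments_integrals p q hp hq) (arcsinh_le_1_threshold p q s hp hq hle)).
enough (0 < p ^ 2 / q ^ 3) by nra.
apply Rmult_lt_0_compat; [nra|apply Rinv_0_lt_compat, pow_lt; lra].
Qed.

(** * From the criterion to strict log-convexity *)

(** At an interior minimum the derivative vanishes; if it is also strictly
    decreasing there, then g decreases to the right of c. *)
Lemma no_interior_min (g dg : R -> R) (d a b c : R) : a < c < b ->
  (forall u, a <= u <= b -> is_derive g u (dg u)) ->
  (dg c = 0 -> is_derive dg c d /\ d < 0) ->
  ~ (forall u, a <= u <= b -> g c <= g u).
Proof.
intros hc hg hd hmin.
assert (h0 : dg c = 0).
{ assert (pr : derivable_pt_lim g c (dg c)) by (apply is_derive_Reals, hg; lra).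
  rewrite <- (derive_pt_eq_0 g c (dg c) (exist _ (dg c) pr) pr).
  apply (deriv_minimum g a b c); try lra.
  intros u hau hub; apply hmin; lra. }
destruct (hd h0) as [hdg hneg].
apply is_derive_Reals in hdg.
destruct (hdg (- d) ltac:(lra)) as [del hdel].
set (h := Rmin (del / 2) (b - c)).
assert (hh : 0 < h <= b - c).
{ split; [apply Rmin_glb_lt; [assert (hp := cond_pos del)|]; lra|apply Rmin_r]. }
assert (hhd : h < del).
{ apply Rle_lt_trans with (1 := Rmin_l _ _); assert (hd' := cond_pos del); lra. }
enough (hlt : g (c + h) < g c) by (assert (h1 := hmin (c + h) ltac:(lra)); lra).
enough (- g c < - g (c + h)) by lra.
apply (strict_monotone_of_derive (fun u => - g u) (fun u => - dg u)); [lra| |].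
- intros u hu; apply (is_derive_opp g), hg; lra.
- intros u hu.
  assert (h1 := hdel (u - c) ltac:(lra) ltac:(rewrite Rabs_pos_eq; lra)).
  replace (c + (u - c)) with u in h1 by ring; rewrite h0, Rminus_0_r in h1.
  apply Rabs_lt_between' in h1.
  assert (h2 : dg u / (u - c) * (u - c) < 0 * (u - c)).
  { apply Rmult_lt_compat_r; lra. }
  unfold Rdiv in h2; rewrite Rmult_assoc, Rinv_l, Rmult_1_r in h2 by lra; lra.
Qed.

(** The derivative of the arcsinh integral along ln x = al q + be. *)
Definition line_slope (p al be q : R) : R :=
  / p * RInt (alpha1 p q) 0 (exp (al * q + be))
  + al * exp (al * q + be) * Rpower (1 + powp (exp (al * q + be)) q) (- / p).

Lemma is_derive_arcsinh_line (p al be q : R) : 1 < q ->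
  is_derive (fun q => arcsinh_pq p q (exp (al * q + be))) q (line_slope p al be q).
Proof.
intros hq; unfold arcsinh_pq; evar_last.
- apply (is_derive_RInt_moving (fun q t => Rpower (1 + powp t q) (- / p))
    (fun q t => / p * alpha1 p q t) (fun q => exp (al * q + be)) q
    (al * exp (al * q + be))); [| | |easy|].
  + intros u t _; apply is_derive_integrand.
  + intros u t hu; apply continuous_arcsinh_integrand; lra.
  + intros u t hu; apply continuity_2d_pt_mult; [apply continuity_2d_pt_const|].
    now apply continuity_2d_alpha1.
  + auto_derive; [easy|ring].
- unfold line_slope; rewrite (RInt_scal (alpha1 p q)).
  + unfold scal; simpl; unfold mult; simpl; ring.
  + apply @ex_RInt_continuous; intros t _; now apply continuous_alpha1.
Qed.

(** At a critical point of the restriction to a line, al equals minus the quotient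
    of the partial derivatives in q and ln x, and the second derivative becomes the
    criterion. Away from critical points it does not. *)
Lemma is_derive_line_slope (p al be q : R) : 1 < p -> 1 < q ->
  line_slope p al be q = 0 ->
  is_derive (line_slope p al be) q ((/ p) ^ 2 * criterion p q (exp (al * q + be))).
Proof.
intros hp hq h0; unfold line_slope in *.
set (l := al * q + be) in *.
evar_last.
- apply @is_derive_plus.
  + apply is_derive_scal.
    apply (is_derive_RInt_moving (alpha1 p) (fun q t => / p * alpha2 p q t)
      (fun q => exp (al * q + be)) q (al * exp (al * q + be))); [| | |easy|].
    * intros u t _; apply is_derive_alpha1; lra.
    * intros u t hu; now apply continuous_alpha1.
    * intros u t hu; apply continuity_2d_pt_mult; [apply continuity_2d_pt_const|].
      now apply continuity_2d_alpha2.
    * auto_derive; [easy|ring].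
  + apply (is_derive_ext (fun q => al * exp (al * q + be)
      * exp (- / p * ln (1 + exp (q * (al * q + be)))))).
    { intros u; rewrite powp_pos, ln_exp by apply exp_pos; reflexivity. }
    auto_derive; [|reflexivity].
    assert (h := exp_pos (q * (al * q + be))); lra.
- fold l; rewrite (RInt_scal (alpha2 p q)).
  2: { apply @ex_RInt_continuous; intros t _; now apply continuous_alpha2. }
  unfold plus, scal; simpl; unfold mult; simpl.
  unfold criterion.
  set (A1 := RInt (alpha1 p q) 0 (exp l)) in *; clearbody A1.
  set (A2 := RInt (alpha2 p q) 0 (exp l)); clearbody A2.
  unfold alpha1; rewrite powp_pos, ln_exp in * by apply exp_pos.
  assert (hX := exp_pos (q * l)).
  replace (1 - / p) with (1 + - / p) by ring.
  rewrite !Rpower_plus, Rpower_1, !Rpower_Ropp in * by lra.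
  replace (exp (- / p * ln (1 + exp (q * l)))) with (/ Rpower (1 + exp (q * l)) (/ p)).
  2: { rewrite <- Rpower_Ropp; reflexivity. }
  assert (hE : 0 < Rpower (1 + exp (q * l)) (/ p)) by apply exp_pos.
  set (E := Rpower (1 + exp (q * l)) (/ p)) in *; clearbody E.
  assert (hx := exp_pos l); set (x := exp l) in *; clearbody x.
  set (X := exp (q * l)) in *; clearbody X.
  assert (eA : A1 = - (p * al * x / E)).
  { apply (Rmult_eq_reg_l (/ p)); [|apply Rinv_neq_0_compat; lra].
    apply (Rplus_eq_reg_r (al * x * / E)); rewrite h0; field; lra. }
  rewrite eA; field; repeat split; lra.
Qed.

(** Superlevel sets of (q, ln x) |-> arcsinh_pq p q x at levels y <= 1 are strictly
    convex: along a segment an interior minimum with value at most y would be a critical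
    point with negative second derivative. *)
Lemma arcsinh_line_gt (p y al be a b : R) : 1 < p -> y <= 1 -> 1 < a ->
  y <= arcsinh_pq p a (exp (al * a + be)) ->
  y <= arcsinh_pq p b (exp (al * b + be)) ->
  forall q, a < q < b -> y < arcsinh_pq p q (exp (al * q + be)).
Proof.
intros hp hy ha hya hyb q hq.
set (g := fun q => arcsinh_pq p q (exp (al * q + be))).
assert (hg : forall u, a <= u <= b -> is_derive g u (line_slope p al be u)).
{ intros u hu; apply is_derive_arcsinh_line; lra. }
apply Rnot_le_lt; intros hle.
(* If the minimum over [a, b] is attained at an end point, then its value is y
   and q is another minimum point. *)
assert (hmin : exists c, a < c < b /\ g c <= 1 /\ forall u, a <= u <= b -> g c <= g u).
{ destruct (continuity_ab_min g a b) as [c [hc hcab]]; [lra| |].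
  - intros u hu; apply continuity_pt_filterlim, @ex_derive_continuous.
    eexists; now apply hg.
  - assert (hcq := hc q ltac:(lra)); change (g q <= y) in hle.
    destruct (Req_dec c a) as [ea|na]; [|destruct (Req_dec c b) as [eb|nb]].
    + exists q; split; [easy|split; [lra|]]; intros u hu.
      assert (h := hc u hu); rewrite ea in h; change (y <= g a) in hya; lra.
    + exists q; split; [easy|split; [lra|]]; intros u hu.
      assert (h := hc u hu); rewrite eb in h; change (y <= g b) in hyb; lra.
    + exists c; split; [lra|split; [lra|easy]]. }
destruct hmin as [c [hc [hc1 hmin]]].
apply (no_interior_min g (line_slope p al be)
  ((/ p) ^ 2 * criterion p c (exp (al * c + be))) a b c hc hg); [|easy].
intros h0; split; [apply is_derive_line_slope; try easy; lra|].
assert (h1 := criterion_neg p c (exp (al * c + be)) hp ltac:(lra) (exp_pos _) hc1).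
assert (0 < / p) by (apply Rinv_0_lt_compat; lra).
assert (0 < (/ p) ^ 2) by nra; nra.
Qed.

(** Existence of the preimage comes from [arcsinh_le_1_threshold]: beyond the
    threshold the arcsinh integral exceeds 1. *)
Lemma sinh_pq_spec (p q y : R) : 1 < p -> 1 < q -> 0 < y <= 1 ->
  0 < sinh_pq p q y /\ arcsinh_pq p q (sinh_pq p q y) = y.
Proof.
intros hp hq hy.
destruct (sinh_pq_inverse p q y) as [h0 h]; [lra|lra| |].
- set (s := ln (1 + (88 / 100 + 87 / 100 * q))).
  apply Rbar_lt_trans with (arcsinh_pq p q (exp (/ q * s))).
  + simpl; apply Rnot_le_lt; intros hle.
    assert (h := arcsinh_le_1_threshold p q s hp hq ltac:(lra)).
    unfold s in h; rewrite exp_ln in h; lra.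
  + apply sinh_pq_arcsinh_pq; [lra|left; apply exp_pos].
- split; [|easy].
  destruct h0 as [h0|h0]; [easy|].
  rewrite <- h0, arcsinh_pq_0 in h; lra.
Qed.

(** Draw the line through the points of the graph of q |-> ln sinh_pq p q y over a
    and b. In between, the arcsinh integral exceeds y on that line, so the graph
    lies strictly below it. *)
Lemma sinh_pq_strictly_log_convex (p y : R) : 1 < p -> 0 < y <= 1 ->
  strictly_log_convex_on (fun q => 1 < q) (fun q => sinh_pq p q y).
Proof.
intros hp hy; split.
{ intros q hq; now apply sinh_pq_spec. }
assert (main : forall a b l, 1 < a -> a < b -> 0 < l < 1 ->
  sinh_pq p (l * a + (1 - l) * b) y
  < Rpower (sinh_pq p a y) l * Rpower (sinh_pq p b y) (1 - l)).
{ intros a b l ha hab hl.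
  destruct (sinh_pq_spec p a y hp ha hy) as [pa ea].
  destruct (sinh_pq_spec p b y hp ltac:(lra) hy) as [pb eb].
  set (q := l * a + (1 - l) * b).
  assert (hq : a < q < b) by (unfold q; nra).
  destruct (sinh_pq_spec p q y hp ltac:(lra) hy) as [pq eq].
  set (al := (ln (sinh_pq p b y) - ln (sinh_pq p a y)) / (b - a)).
  set (be := ln (sinh_pq p a y) - al * a).
  assert (ela : al * a + be = ln (sinh_pq p a y)) by (unfold be; ring).
  assert (elb : al * b + be = ln (sinh_pq p b y)) by (unfold be, al; field; lra).
  assert (elq : Rpower (sinh_pq p a y) l * Rpower (sinh_pq p b y) (1 - l)
    = exp (al * q + be)).
  { unfold Rpower; rewrite <- exp_plus, <- ela, <- elb; f_equal; unfold q; ring. }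
  rewrite elq; apply Rnot_le_lt; intros hle.
  assert (hgt := arcsinh_line_gt p y al be a b hp ltac:(lra) ha
    ltac:(rewrite ela, exp_ln; lra) ltac:(rewrite elb, exp_ln; lra) q hq).
  destruct hle as [hle|hle].
  - apply (arcsinh_pq_increasing p q) in hle; lra.
  - rewrite hle in hgt; lra. }
intros a b l ha hb hab hl.
destruct (Rtotal_order a b) as [h|[h|h]]; [now apply main|easy|].
assert (hba := main b a (1 - l) hb h ltac:(lra)).
replace (1 - (1 - l)) with l in hba by ring.
rewrite Rplus_comm, (Rmult_comm (Rpower _ _)); exact hba.
Qed.

Lemma strictly_log_convex_on_log_convex (I : R -> Prop) (f : R -> R) :
  strictly_log_convex_on I f -> log_convex_on I f.
Proof.
intros [hpos h]; split; [easy|].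
intros a b l ha hb hl.
assert (pa := hpos a ha); assert (pb := hpos b hb).
destruct (Req_dec a b) as [<-|hab].
{ rewrite <- Rpower_plus.
  replace (l + (1 - l)) with 1 by ring; rewrite Rpower_1 by easy.
  right; f_equal; ring. }
destruct (Req_dec l 0) as [->|h0].
{ replace (0 * a + (1 - 0) * b) with b by ring.
  rewrite Rpower_O, Rminus_0_r, Rpower_1, Rmult_1_l by easy; lra. }
destruct (Req_dec l 1) as [->|h1].
{ replace (1 * a + (1 - 1) * b) with a by ring.
  rewrite Rminus_diag_eq, Rpower_O, Rpower_1, Rmult_1_r by easy; lra. }
left; apply h; try easy; lra.
Qed.

Theorem corollary4 (p y : R) (hp : 1 < p) (hy : 0 < y <= 1) :
  (log_convex_on (fun q => 1 < q) (fun q => sinh_pq p q y) <->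
     (forall q, 1 < q -> criterion p q (sinh_pq p q y) <= 0)) /\
  (strictly_log_convex_on (fun q => 1 < q) (fun q => sinh_pq p q y) <->
     (forall q, 1 < q -> criterion p q (sinh_pq p q y) < 0)).
Proof.
assert (hconv := sinh_pq_strictly_log_convex p y hp hy).
assert (hcrit : forall q, 1 < q -> criterion p q (sinh_pq p q y) < 0).
{ intros q hq; destruct (sinh_pq_spec p q y hp hq hy) as [h0 h].
  apply criterion_neg; lra. }
split; split; intros _.
- intros q hq; left; now apply hcrit.
- now apply strictly_log_convex_on_log_convex.
- exact hcrit.
- exact hconv.
Qed.
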